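(* Let $M\models\mathsf{ZF}$ be countable. Then $M$ has a minimal $\mathsf{KM}$-realization if and only if $M$ has a $\beta$-$\mathsf{KM}$-realization.
   Context: Models of second-order set theory are pairs $(M,\mathcal X)$ with $\mathcal X\subseteq\mathcal P(M)$. $\mathsf{KM}$ (Kelley–Morse) consists of $\mathsf{ZF}$ for sets, Extensionality for classes, Class Replacement (the image of a set under a class function is a set), and comprehension for all second-order formulas (with set and class parameters). $\mathcal X$ is a $\mathsf{KM}$-realization for $M$ if $(M,\mathcal X)\models\mathsf{KM}$; it is minimal if no $\mathsf{KM}$-realization for $M$ is a proper subset of it. It is a $\beta$-$\mathsf{KM}$-realization if moreover $M$ is transitive (true $\in$) and every $R\in\mathcal X$ which $(M,\mathcal X)$ thinks is well-founded really is well-founded. *)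

(* Defs.v *)
From mathcomp Require Import all_boot.
From mathcomp Require Import boolp classical_sets cardinality.

Set Implicit Arguments.
Unset Strict Implicit.
Unset Printing Implicit Defensive.

Local Open Scope classical_set_scope.

(* Formulas use de Bruijn indices, separately for set and class variables;
   index 0 is the innermost bound variable of its sort. *)
Definition scons {T : Type} (x : T) (v : nat -> T) (n : nat) : T :=
  if n is k.+1 then v k else x.

Inductive formula1 : Type :=
| Mem1 of nat & nat
| Eq1 of nat & nat
| Bot1
| Imp1 of formula1 & formula1
| All1 of formula1.

Fixpoint sat1 (M : Type) (E : M -> M -> Prop) (v : nat -> M)
    (phi : formula1) : Prop :=
  match phi with
  | Mem1 i j => E (v i) (v j)
  | Eq1 i j => v i = v j
  | Bot1 => False
  | Imp1 p q => sat1 E v p -> sat1 E v q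
  | All1 p => forall x, sat1 E (scons x v) p
  end.

Inductive formula2 : Type :=
| Mem2 of nat & nat
| Eq2 of nat & nat
| In2 of nat & nat   (* set variable in class variable *)
| ClassEq2 of nat & nat
| Bot2
| Imp2 of formula2 & formula2
| All2 of formula2
| ClassAll2 of formula2.

Fixpoint sat2 (M : Type) (E : M -> M -> Prop) (X : set (set M))
    (v : nat -> M) (V : nat -> set M) (phi : formula2) : Prop :=
  match phi with
  | Mem2 i j => E (v i) (v j)
  | Eq2 i j => v i = v j
  | In2 i k => V k (v i)
  | ClassEq2 k l => V k = V l
  | Bot2 => False
  | Imp2 p q => sat2 E X v V p -> sat2 E X v V q
  | All2 p => forall x, sat2 E X (scons x v) V p
  | ClassAll2 p => forall A, X A -> sat2 E X v (scons A V) p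
  end.

Record ZF (M : Type) (E : M -> M -> Prop) : Prop := {
  ZF_extensionality : forall a b, (forall x, E x a <-> E x b) -> a = b;
  ZF_foundation : forall a, (exists x, E x a) ->
    exists x, E x a /\ ~ (exists y, E y x /\ E y a);
  ZF_pairing : forall a b, exists c, forall x, E x c <-> x = a \/ x = b;
  ZF_union : forall a, exists u, forall x,
    E x u <-> exists y, E y a /\ E x y;
  ZF_powerset : forall a, exists p, forall x,
    E x p <-> (forall z, E z x -> E z a);
  ZF_infinity : exists w,
    (exists e, (forall z, ~ E z e) /\ E e w) /\
    (forall x, E x w ->
       exists s, (forall z, E z s <-> E z x \/ z = x) /\ E s w);
  ZF_separation : forall (phi : formula1) (v : nat -> M) (a : M),
    exists b, forall x, E x b <-> E x a /\ sat1 E (scons x v) phi;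
  ZF_replacement : forall (phi : formula1) (v : nat -> M) (a : M),
    (forall x, E x a -> exists! y, sat1 E (scons x (scons y v)) phi) ->
    exists b, forall y,
      E y b <-> exists x, E x a /\ sat1 E (scons x (scons y v)) phi }.

Definition is_upair (M : Type) (E : M -> M -> Prop) (c x y : M) : Prop :=
  forall z, E z c <-> z = x \/ z = y.

(* [p] is the Kuratowski pair {{x}, {x, y}} as computed in [M]. *)
Definition is_opair (M : Type) (E : M -> M -> Prop) (p x y : M) : Prop :=
  exists a b, is_upair E a x x /\ is_upair E b x y /\ is_upair E p a b.

Definition rel_of (M : Type) (E : M -> M -> Prop) (R : set M) (x y : M) : Prop :=
  exists p, is_opair E p x y /\ R p.

Definition class_relation (M : Type) (E : M -> M -> Prop) (R : set M) : Prop :=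
  forall p, R p -> exists x y, is_opair E p x y.

Definition class_function (M : Type) (E : M -> M -> Prop) (F : set M) : Prop :=
  class_relation E F /\
  forall x y z, rel_of E F x y -> rel_of E F x z -> y = z.

Record KM (M : Type) (E : M -> M -> Prop) (X : set (set M)) : Prop := {
  KM_ZF : ZF E;
  (* The sorts of a structure are nonempty. This has to be said, as otherwise
     there is no assignment of the class variables to elements of [X] and
     comprehension below holds vacuously. *)
  KM_nonempty : X !=set0;
  KM_class_extensionality : forall A B, X A -> X B ->
    (forall x, A x <-> B x) -> A = B;
  KM_class_replacement : forall F, X F -> class_function E F ->
    forall a, exists b, forall y, E y b <-> exists x, E x a /\ rel_of E F x y;
  (* The parameters are the values of [v] and [V]. *)
  KM_comprehension : forall (phi : formula2) (v : nat -> M) (V : nat -> set M),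
    (forall k, X (V k)) -> X [set x | sat2 E X (scons x v) V phi] }.

Definition KM_realization (M : Type) (E : M -> M -> Prop)
    (X : set (set M)) : Prop := KM E X.

Definition minimal_KM_realization (M : Type) (E : M -> M -> Prop)
    (X : set (set M)) : Prop :=
  KM_realization E X /\ forall Y, KM_realization E Y -> ~ (Y `<` X).

(* Aczel's iterative sets, with extensional equality [veq] and the true
   membership relation [vmem]. *)
Inductive vset : Type := VSup (A : Type) (f : A -> vset).

Fixpoint veq (a b : vset) : Prop :=
  match a, b with
  | VSup A f, VSup B g =>
      (forall x : A, exists y : B, veq (f x) (g y)) /\
      (forall y : B, exists x : A, veq (f x) (g y))
  end.

Definition vmem (a b : vset) : Prop :=
  match b with VSup B g => exists y : B, veq a (g y) end.

(* Being transitive is understood up to isomorphism: [c] identifies [(M, E)]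
   with a transitive collection of sets under true membership. *)
Definition transitive_model (M : Type) (E : M -> M -> Prop) : Prop :=
  exists c : M -> vset,
    (forall x y, veq (c x) (c y) -> x = y) /\
    (forall x y, E x y <-> vmem (c x) (c y)) /\
    (forall z y, vmem z (c y) -> exists x, veq z (c x)).

(* Every nonempty member of [C] has an [R]-minimal element. Well-foundedness
   in the sense of [(M, X)] is the case [C = X], true well-foundedness the case
   where [C] consists of all subsets of [M]. *)
Definition wf_for (M : Type) (C : set (set M)) (R : M -> M -> Prop) : Prop :=
  forall A, C A -> A !=set0 -> exists x, A x /\ forall y, A y -> ~ R y x.

Definition beta_KM_realization (M : Type) (E : M -> M -> Prop)
    (X : set (set M)) : Prop :=
  [/\ KM_realization E X, transitive_model E &
      forall R, X R -> class_relation E R ->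
        wf_for X (rel_of E R) -> wf_for setT (rel_of E R)].

(* Main.v *)
Require Import Defs.
From mathcomp Require Import all_boot.
From mathcomp Require Import boolp classical_sets cardinality.

Set Implicit Arguments.
Unset Strict Implicit.
Unset Printing Implicit Defensive.

Local Open Scope classical_set_scope.

(** Let [(M, X)] be a model of KM. A class [A] codes the family [fam A] of
    its sections at the names [(0, n)]. The canonical code of a family [F] lists
    a hull in [(M, F)] under least witness functions, with names in [M], together
    with the truth definition of [(M, F)]. The good classes are obtained by
    iterating this from the empty class. Like von Neumann ordinals they are well
    ordered by [below], and they take the place of the levels of [L(M)]: the
    candidates for realizations are the families [sections F] of all sections
    of members of an initial segment [F] of the good classes.

    If some class codes the family of all good classes, then its canonical code
    is good, hence belongs to the family, so the hull is a proper elementary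
    initial segment; this gives comprehension for its sections. Otherwise,
    because codes are canonical, least witnesses chosen for all sets can be
    merged into one class, so collection and reflection hold for good classes,
    and the sections of all good classes satisfy comprehension.

    If [X] is a beta-realization, then the good classes are truly well ordered,
    and the least initial segment whose sections form a realization gives a
    minimal one, since goodness passes from a smaller realization to [X]: a
    class without minimal element contains a set without minimal element.

    If [X] is minimal and some relation of [X] is ill-founded although [X]
    contains no witness, consider the game of building good classes
    [A_0, A_1, ...] below a fixed good class, each elementary in the next one
    for formulas of one more quantifier. Reflection wins it for any number of
    rounds in the well-founded part, so by overspill for an ill-founded one,
    which gives an infinite chain. The sections of its members form a
    realization, and it misses a diagonal class. *)

(** * Renaming of variables, and assignments with parameters *)

Definition lift_ren (f : nat -> nat) (n : nat) : nat :=
  if n is k.+1 then (f k).+1 else 0.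

Fixpoint rename2 (f g : nat -> nat) (phi : formula2) : formula2 :=
  match phi with
  | Mem2 i j => Mem2 (f i) (f j)
  | Eq2 i j => Eq2 (f i) (f j)
  | In2 i k => In2 (f i) (g k)
  | ClassEq2 k l => ClassEq2 (g k) (g l)
  | Bot2 => Bot2
  | Imp2 p q => Imp2 (rename2 f g p) (rename2 f g q)
  | All2 p => All2 (rename2 (lift_ren f) g p)
  | ClassAll2 p => ClassAll2 (rename2 f (lift_ren g) p)
  end.

Lemma scons_lift_ren (T : Type) (x : T) (v : nat -> T) (f : nat -> nat) :
  scons x v \o lift_ren f = scons x (v \o f).
Proof. by apply: funext => -[|n]. Qed.

Lemma sat2_rename (M : Type) (E : M -> M -> Prop) (X : set (set M)) phi :
  forall f g v V,
  sat2 E X v V (rename2 f g phi) <-> sat2 E X (v \o f) (V \o g) phi.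
Proof.
elim: phi => //=.
- by move=> p IHp q IHq f g v V; rewrite IHp IHq.
- move=> p IHp f g v V; split=> H x; move: (H x).
  + by rewrite IHp scons_lift_ren.
  + by rewrite IHp scons_lift_ren.
- move=> p IHp f g v V; split=> H A XA; move: (H A XA).
  + by rewrite IHp scons_lift_ren.
  + by rewrite IHp scons_lift_ren.
Qed.

(** An index either reads a variable or holds a parameter, so a formula carries its parameters in
    the index map and not in the assignment. *)
Definition interp (T : Type) (f : nat -> nat + T) (v : nat ->
  T) (i : nat) : T :=
  match f i with inl j => v j | inr a => a end.

(** Two formulas with different index maps are brought under one map: even indices go to the first,
    odd ones to the second. *)
Definition itlv (T : Type) (f g : nat -> T) (n : nat) : T :=
  if odd n then g n./2 else f n./2.

Lemma itlv_even (T : Type) (f g : nat -> T) n : itlv f g n.*2 = f n.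
Proof. by rewrite /itlv odd_double doubleK. Qed.

Lemma itlv_odd (T : Type) (f g : nat -> T) n : itlv f g n.*2.+1 = g n.
Proof. by rewrite /itlv /= odd_double /= uphalf_double. Qed.

(** Several indices may stand for variable 0. To bind that variable, [rename0] sends all of them to
    the bound index 0 and shifts the others; [sub0] fills the vacated indices with the dummy [c]. *)
Definition sub0 (T : Type) (f : nat -> nat + T) (c : nat + T) (i : nat) :=
  match f i with inl 0 => c | inl j.+1 => inl j | inr a => inr a end.

Definition rename0 (T : Type) (f : nat -> nat + T) (i : nat) : nat :=
  match f i with inl 0 => 0 | _ => i.+1 end.

Lemma interp_scons (T : Type) (f : nat -> nat + T) c x v :
  interp f (scons x v) = scons x (interp (sub0 f c) v) \o rename0 f.
Proof.
apply: funext => i; rewrite /interp /= /rename0.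
by case Ef: (f i) => [[|j]|a] //=; rewrite /sub0 Ef.
Qed.

(** * Definability with parameters over [(M, X)] *)

Section Definable.
Variables (M : Type) (E : M -> M -> Prop) (X : set (set M)).

Definition env_in (V : nat -> set M) := forall k, X (V k).

(* Definability over [(M, X)] with parameters, stated for predicates of
   assignments so that it is closed under connectives and quantifiers. *)
Definition definable (Q : (nat -> M) -> (nat -> set M) -> Prop) : Prop :=
  exists phi f g, (forall k A, g k = inr A -> X A) /\
    forall v V, env_in V ->
      (Q v V <-> sat2 E X (interp f v) (interp g V) phi).

Lemma definable_ext Q Q' :
  (forall v V, env_in V -> (Q v V <-> Q' v V)) -> definable Q -> definable Q'.
Proof.
move=> QQ' [phi [f [g [Xg H]]]]; exists phi, f, g; split=> // v V XV.
by rewrite -QQ' // H.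
Qed.

Lemma definable_bot : definable (fun _ _ => False).
Proof. by exists Bot2, inl, inl. Qed.

Lemma definable_imp Q R : definable Q -> definable R ->
  definable (fun v V => Q v V -> R v V).
Proof.
move=> [p [f [g [Xg Hp]]]] [q [f' [g' [Xg' Hq]]]].
exists (Imp2 (rename2 double double p)
             (rename2 (fun n => n.*2.+1) (fun n => n.*2.+1) q)).
exists (itlv f f'), (itlv g g'); split.
  by move=> k A; rewrite /itlv; case: odd; [apply: Xg'|apply: Xg].
move=> v V XV; rewrite Hp // Hq //= !sat2_rename.
have -> : interp (itlv f f') v \o double = interp f v.
  by apply: funext => i; rewrite /interp /= itlv_even.
have -> : interp (itlv g g') V \o double = interp g V.
  by apply: funext => i; rewrite /interp /= itlv_even.
have -> : interp (itlv f f') v \o (fun n => n.*2.+1) = interp f' v.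
  by apply: funext => i; rewrite /interp /= itlv_odd.
have -> // : interp (itlv g g') V \o (fun n => n.*2.+1) = interp g' V.
by apply: funext => i; rewrite /interp /= itlv_odd.
Qed.

Lemma env_in_scons A V : X A -> env_in V -> env_in (scons A V).
Proof. by move=> XA XV [|k] /=. Qed.

Lemma definable_all Q :
  definable (fun v V => Q (v 0) (fun n => v n.+1) V) ->
  definable (fun v V => forall x, Q x v V).
Proof.
move=> [p [f [g [Xg Hp]]]].
exists (All2 (rename2 (rename0 f) id p)), (sub0 f (inl 0)), g;
  split=> // v V XV /=.
split=> H x; move: (H x).
  by rewrite sat2_rename -interp_scons -(Hp (scons x v)).
by rewrite sat2_rename -interp_scons -(Hp (scons x v)).
Qed.

Lemma definable_call Q :
  definable (fun v V => Q (V 0) v (fun n => V n.+1)) ->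
  definable (fun v V => forall A, X A -> Q A v V).
Proof.
move=> [p [f [g [Xg Hp]]]].
exists (ClassAll2 (rename2 id (rename0 g) p)), f, (sub0 g (inl 0)); split.
  move=> k A; rewrite /sub0; case Eg: (g k) => [[|j]|B] //= [<-].
  exact: Xg Eg.
move=> v V XV /=; split=> H A XA; move: (H A XA).
  by rewrite sat2_rename -interp_scons -(Hp v (scons A V)) //;
    apply: env_in_scons.
by rewrite sat2_rename -interp_scons -(Hp v (scons A V)) //;
  apply: env_in_scons.
Qed.

Lemma definable_ren Q f g :
  definable Q -> definable (fun v V => Q (fun n => v (f n)) (fun n => V (g n))).
Proof.
move=> [p [f' [g' [Xg Hp]]]].
pose tr (T : Type) (h : nat -> nat) (k : nat -> nat + T) n :=
  match k n with inl j => inl (h j) | inr a => inr a end.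
exists p, (tr _ f f'), (tr _ g g'); split.
  by move=> k A; rewrite /tr; case Eg: (g' k) => [j|B] //= [<-]; apply: Xg Eg.
move=> v V XV; rewrite Hp; last by move=> k; apply: XV.
have -> : interp f' (fun n => v (f n)) = interp (tr _ f f') v.
  by apply: funext => i; rewrite /interp /tr; case: (f' i).
have -> // : interp g' (fun n => V (g n)) = interp (tr _ g g') V.
by apply: funext => i; rewrite /interp /tr; case: (g' i).
Qed.

(** Freezing every variable but set variable 0 is what makes each value of a definable class term a
    class of [X]. *)
Lemma definable_fixparams Q w W : env_in W -> definable Q ->
  definable (fun v V => Q (scons (v 0) w) W).
Proof.
move=> XW [p [f [g [Xg Hp]]]].
exists p, (fun n => match f n with inl 0 => inl 0 | inl j.+1 => inr (w j)
   | inr a => inr a end), (fun n => inr (interp g W n)); split.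
  move=> k A [<-]; rewrite /interp; case Eg: (g k) => [j|B] //.
  exact: Xg Eg.
move=> v V XV; rewrite Hp //.
have -> // : interp f (scons (v 0) w) = interp (fun n => match f n with inl 0
  => inl 0 | inl j.+1 => inr (w j)
   | inr a => inr a end) v.
by apply: funext => i; rewrite /interp; case: (f i) => [[|j]|a].
Qed.

Lemma definable_not Q : definable Q -> definable (fun v V => ~ Q v V).
Proof. by move=> HQ; apply: definable_imp HQ definable_bot. Qed.

Lemma definable_true : definable (fun _ _ => True).
Proof. by apply: (definable_ext _ (definable_not definable_bot)) => v V _;
  split=> // _ []. Qed.

Lemma definable_and Q R : definable Q -> definable R ->
  definable (fun v V => Q v V /\ R v V).
Proof.
move=> HQ HR; apply: (definable_ext _ (definable_not (definable_imp HQ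
  (definable_not HR)))) => v V _.
by split=> [/not_implyP[? /contrapT]|[? ?] H] //; apply: H.
Qed.

Lemma definable_or Q R : definable Q -> definable R ->
  definable (fun v V => Q v V \/ R v V).
Proof.
move=> HQ HR; apply: (definable_ext _ (definable_imp (definable_not HQ) HR)) =>
  v V _.
split=> [H|[]//]; case: (pselect (Q v V)) => [|/H]; by [left|right].
Qed.

Lemma definable_iff Q R : definable Q -> definable R ->
  definable (fun v V => Q v V <-> R v V).
Proof. by move=> HQ HR; apply: definable_and; apply: definable_imp. Qed.

Lemma definable_ex Q :
  definable (fun v V => Q (v 0) (fun n => v n.+1) V) ->
  definable (fun v V => exists x, Q x v V).
Proof.
move=> HQ; have := definable_not (definable_all (Q := fun x v V => ~ Q x v V)
  (definable_not HQ)).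
apply: definable_ext => v V _; split=> [H|[x Qx] H]; last exact: (H x).
apply: contrapT => H'; apply: H => x Qx; apply: H'; by exists x.
Qed.

Lemma definable_cex Q :
  definable (fun v V => Q (V 0) v (fun n => V n.+1)) ->
  definable (fun v V => exists A, X A /\ Q A v V).
Proof.
move=> HQ; have := definable_not (definable_call (Q := fun x v V => ~ Q x v V)
  (definable_not HQ)).
apply: definable_ext => v V _; split=> [H|[A [XA QA]] H]; last exact: (H A).
apply: contrapT => H'; apply: H => A XA QA; apply: H'; by exists A.
Qed.

Definition definable_term (t : (nat -> M) -> (nat -> set M) -> M) :=
  definable (fun v V => v 0 = t (fun n => v n.+1) V).

Definition definable_class (K : (nat -> M) -> (nat -> set M) -> set M) :=
  definable (fun v V => K (fun n => v n.+1) V (v 0)).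

Lemma definable_term_var i : definable_term (fun v _ => v i).
Proof.
exists (Eq2 0 1), (fun n => if n is 0 then inl 0 else inl i.+1), inl.
by split.
Qed.

Lemma definable_term_const a : definable_term (fun _ _ => a).
Proof.
exists (Eq2 0 1), (fun n => if n is 0 then inl 0 else inr a), inl.
by split.
Qed.

Lemma definable_term_ren t f g :
  definable_term t -> definable_term (fun v V => t (fun n => v (f n)) (fun n =>
    V (g n))).
Proof. by move=> Ht; apply: (definable_ren (lift_ren f) g Ht). Qed.

Lemma definable_class_ren K f g :
  definable_class K -> definable_class (fun v V => K (fun n => v (f n)) (fun n
    => V (g n))).
Proof. by move=> Ht; apply: (definable_ren (lift_ren f) g Ht). Qed.

Lemma definable_mterm Q t : definable_term t ->
  definable (fun v V => Q (v 0) (fun n => v n.+1) V) ->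
  definable (fun v V => Q (t v V) v V).
Proof.
move=> Ht HQ.
have := definable_all (Q := fun x v V => x = t v V ->
  Q x v V) (definable_imp Ht HQ).
by apply: definable_ext => v V _; split=> [|? ? ->]; first exact.
Qed.

Lemma definable_in K t : definable_class K -> definable_term t ->
  definable (fun v V => K v V (t v V)).
Proof. by move=> HK Ht;
  apply: (definable_mterm (Q := fun x v V => K v V x) Ht HK). Qed.

Lemma definable_mem t u : definable_term t -> definable_term u ->
  definable (fun v V => E (t v V) (u v V)).
Proof.
move=> Ht Hu; apply: (definable_mterm (Q := fun x v V => E x (u v V)) Ht).
have Hu' := definable_term_ren succn id Hu.
apply: (definable_mterm (Q := fun x v V => E (v 0) x) Hu').
exists (Mem2 1 0), inl, inl; by split.
Qed.

Lemma definable_eq t u : definable_term t -> definable_term u ->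
  definable (fun v V => t v V = u v V).
Proof. by move=> Ht Hu;
  apply: (definable_mterm (Q := fun x v V => x = u v V) Ht Hu). Qed.

Lemma definable_class_var i : definable_class (fun _ V => V i).
Proof.
exists (In2 0 0), (fun n => inl 0), (fun n => inl i).
by split.
Qed.

Lemma definable_class_const A : X A -> definable_class (fun _ _ => A).
Proof.
move=> XA; exists (In2 0 0), (fun n => inl 0), (fun n => inr A).
by split=> // k B [<-].
Qed.

Lemma definable_ceq K L : definable_class K -> definable_class L ->
  definable (fun v V => K v V = L v V).
Proof.
move=> HK HL.
have := definable_all (Q := fun x v V => K v V x <-> L v V x) (definable_iff HK
  HL).
apply: definable_ext => v V _; split=> [H|-> //].
by apply/seteqP; split=> x /H.
Qed.

End Definable.

(** * Proof search for definability; the [_user] hooks are redefined as new notions arrive *)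

Ltac pd_user := fail.
Ltac dt_user := fail.
Ltac dc_user := fail.

Ltac dt :=
  cbv beta;
  lazymatch goal with
  | |- definable_term _ _ (fun v V => v ?i) => apply: definable_term_var
  | _ => first
    [ dt_user
    | apply: definable_term_const
    | match goal with H : definable_term _ _ _ |- _ => exact
      (definable_term_ren _ _ H) end ]
  end.

Ltac dc :=
  cbv beta;
  lazymatch goal with
  | |- definable_class _ _ (fun v V => V ?i) => apply: definable_class_var
  | _ => first
    [ dc_user
    | apply: definable_class_const; by []
    | match goal with H : definable_class _ _ _ |- _ => exact
      (definable_class_ren _ _ H) end ]
  end.

Ltac pd_in :=
  lazymatch goal with |- @definable ?M ?E ?X ?Q =>
    let K := constr:(fun (v : nat -> M) (V : nat -> set M) => ltac:(
      let q := eval cbv beta in (Q v V) in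
      match q with ?A ?t => exact A end) : set M) in
    let K := eval cbv beta in K in
    let u := constr:(fun (v : nat -> M) (V : nat -> set M) => ltac:(
      let q := eval cbv beta in (Q v V) in
      match q with ?A ?t => exact t end)) in
    refine (@definable_in M E X K u _ _)
  end.

Ltac pd :=
  cbv beta;
  lazymatch goal with
  | |- definable_term _ _ _ => dt
  | |- definable_class _ _ _ => dc
  | |- definable _ _ (fun v V => True) => apply: definable_true
  | |- definable _ _ (fun v V => False) => apply: definable_bot
  | |- definable _ _ (fun v V => ~ _) => apply: definable_not; pd
  | |- definable _ _ (fun v V => _ /\ _) => apply: definable_and; pd
  | |- definable _ _ (fun v V => _ \/ _) => apply: definable_or; pd
  | |- definable _ _ (fun v V => _ <-> _) => apply: definable_iff; pd
  | |- definable _ _ (fun v V => @eq (set _) _ _) => apply: definable_ceq; pd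
  | |- definable _ _ (fun v V => @eq _ _ _) => apply: definable_eq; pd
  | |- definable _ _ (fun v V => exists A : set _, _ /\ _) => apply:
    definable_cex; pd
  | |- definable _ _ (fun v V => exists x, _) => apply: definable_ex; pd
  | |- definable _ _ (fun v V => forall A : set _, _ ->
    _) => apply: definable_call; pd
  | |- definable _ _ (fun v V => ?P -> ?Q) => apply: definable_imp; pd
  | |- definable _ _ (fun v V => forall x, _) => apply: definable_all; pd
  | |- definable ?E _ (fun v V => ?E _ _) => apply: definable_mem; dt
  | _ => first [ pd_user; pd
               | match goal with H : definable _ _ _ |- _ => exact
      (definable_ren _ _ H) end
               | pd_in; pd ]
  end.

(** * Pairs, numerals and assignments inside [M] *)

Section Pairs.
Variables (M : Type) (E : M -> M -> Prop) (Zf : ZF E).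

Definition upr (x y : M) : M := sval (cid (ZF_pairing Zf x y)).

Lemma uprP x y z : E z (upr x y) <-> z = x \/ z = y.
Proof. by rewrite /upr; case: cid. Qed.

Lemma upr_eq p x y : is_upair E p x y <-> p = upr x y.
Proof.
split=> [H|-> z]; last exact: uprP.
by apply: (ZF_extensionality Zf) => z; rewrite uprP.
Qed.

Definition sing x := upr x x.
Definition pr x y := upr (sing x) (upr x y).

Lemma opair_pr p x y : is_opair E p x y <-> p = pr x y.
Proof.
split=> [[a [b [/upr_eq -> [/upr_eq -> /upr_eq ->]]]]//|->].
by exists (sing x), (upr x y); split; [|split]; apply/upr_eq.
Qed.

Lemma singP x z : E z (sing x) <-> z = x.
Proof. by rewrite uprP; split=> [[]|->] //; left. Qed.

Lemma sing_inj x y : sing x = sing y -> x = y.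
Proof. by move=> H; apply/singP; rewrite -H singP. Qed.

Lemma upr_injr x y z : upr x y = upr x z -> y = z.
Proof.
move=> H; have : E y (upr x z) by rewrite -H uprP; right.
have : E z (upr x y) by rewrite H uprP; right.
by rewrite !uprP => -[->|-> //] [->|->].
Qed.

Lemma pr_inj x y x' y' : pr x y = pr x' y' -> x = x' /\ y = y'.
Proof.
rewrite /pr => H.
have ex : x = x'.
  have : E (sing x) (upr (sing x') (upr x' y')) by rewrite -H uprP; left.
  rewrite uprP => -[/sing_inj //|H'].
  by have /singP : E x' (sing x) by rewrite H' uprP; left.
by split=> //; subst x'; move/upr_injr/upr_injr: H.
Qed.

Lemma pr_injE x y x' y' : pr x y = pr x' y' <-> x = x' /\ y = y'.
Proof. by split=> [/pr_inj//|[-> ->]]. Qed.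

Lemma emp_ex : exists e, forall z, ~ E z e.
Proof. by have [w [[e [He _]] _]] := ZF_infinity Zf; exists e. Qed.

Definition emp : M := sval (cid emp_ex).

Lemma empP z : ~ E z emp.
Proof. by rewrite /emp; case: cid. Qed.

(** Zermelo numerals: [num j] is the only element of [num j.+1], so a recursion that looks at all
    elements of its index goes from [num j.+1] to [num j] alone. They also serve as tags. *)
Fixpoint num (k : nat) : M := if k is j.+1 then sing (num j) else emp.

Lemma num_inj : injective num.
Proof.
elim=> [|i IH] [|j] //=.
- by move=> H; case: (@empP (num j)); rewrite H singP.
- by move=> H; case: (@empP (num i)); rewrite -H singP.
- by move/sing_inj/IH => ->.
Qed.

Lemma mem_num m k : E m (num k) <-> exists2 j, k = j.+1 & m = num j.
Proof.
case: k => [|k] /=; first by split=> [/empP|[]].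
by rewrite singP; split=> [->|[j [->]]] //; exists k.
Qed.

Definition sec (A : set M) (x : M) : set M := fun y => A (pr x y).

Definition upd (e i y e' : M) : Prop :=
  forall p, E p e' <-> (E p e /\ ~ exists z, p = pr i z) \/ p = pr i y.

Lemma upd_same e i y e' z : upd e i y e' -> (E (pr i z) e' <-> z = y).
Proof.
move=> ->; rewrite pr_injE; split=> [[[_ []]|[]]|->] //; last by right.
by exists z.
Qed.

Lemma upd_other e i y e' j z : upd e i y e' -> j <> i ->
  (E (pr j z) e' <-> E (pr j z) e).
Proof.
move=> -> ne; rewrite pr_injE; split=> [[[] //|[]]|] // H.
by left; split=> // -[w /pr_inj[]].
Qed.

End Pairs.

Arguments pr_inj {M E Zf x y x' y'}.
Arguments num_inj {M E Zf} x1 x2.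
Arguments empP {M E Zf z}.
Arguments singP {M E Zf x z}.
Arguments uprP {M E Zf x y z}.
Arguments opair_pr {M E} Zf {p x y}.

(** * Comprehension for definable predicates, and definable class terms *)

Section Comprehension.
Variables (M : Type) (E : M -> M -> Prop) (Zf : ZF E) (X : set (set M)).
Hypothesis K : KM E X.
Notation definable := (definable E X).
Notation definable_term := (definable_term E X).
Notation definable_class := (definable_class E X).
Notation env_in := (env_in X).
Notation pr := (pr Zf).
Notation sec := (sec Zf).

Lemma class_comprehension Q : definable (fun v V => Q (v 0)) -> X [set x | Q x].
Proof.
move=> [p [f [g [Xg Hp]]]].
(* [Q] reads only variable 0, so all other variables may get arbitrary values; [KM_nonempty]
   provides one for the class variables. *)
have [A XA] := KM_nonempty K.
have XV : env_in (fun=> A) by [].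
pose a := emp (KM_ZF K).
have -> : [set x | Q x] =
  [set x | sat2 E X (scons x (interp (sub0 f (inl 0)) (fun=> a)))
     (interp g (fun=> A)) (rename2 (rename0 f) id p)].
  apply/predeqP => x /=; rewrite sat2_rename -interp_scons.
  exact: (Hp (scons x (fun=> a))).
apply: (KM_comprehension K) => k; rewrite /interp.
by case Eg: (g k) => [j|B] //; apply: Xg Eg.
Qed.

Lemma definable_class_X F v V : definable_class F -> env_in V -> X (F v V).
Proof.
move=> HF XV; exact: (class_comprehension (Q := fun x => F v V x)
  (definable_fixparams v XV HF)).
Qed.

(** Substitution is done by quantifying over the classes equal to [F v V]; comprehension ensures
    that the quantifier reaches this class. *)
Lemma definable_cterm Q F : definable_class F ->
  definable (fun v V => Q (V 0) v (fun n => V n.+1)) ->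
  definable (fun v V => Q (F v V) v V).
Proof.
move=> HF HQ.
have := definable_call (Q := fun A v V => A = F v V -> Q A v V)
  (definable_imp (definable_ceq (definable_class_var E X 0)
    (definable_class_ren id succn HF)) HQ).
apply: definable_ext => v V XV; split=> [H|H A _ -> //].
by apply: H => //; apply: definable_class_X.
Qed.

Lemma definable_opair t u w : definable_term t -> definable_term u ->
  definable_term w ->
  definable (fun v V => is_opair E (t v V) (u v V) (w v V)).
Proof. by move=> Ht Hu Hw; rewrite /is_opair /is_upair; pd. Qed.

Lemma definable_term_upr t u : definable_term t -> definable_term u ->
  definable_term (fun v V => upr Zf (t v V) (u v V)).
Proof.
move=> Ht Hu.
have : definable (fun v V => forall z, E z (v 0) <-> z = t (fun n => v n.+1) V
  \/
   z = u (fun n => v n.+1) V) by pd.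
by apply: definable_ext => v V _; rewrite -(upr_eq Zf).
Qed.

Lemma definable_term_pr t u : definable_term t -> definable_term u ->
  definable_term (fun v V => pr (t v V) (u v V)).
Proof. by move=> Ht Hu; do !apply: definable_term_upr. Qed.

Lemma definable_class_sec F t : definable_class F -> definable_term t ->
  definable_class (fun v V => sec (F v V) (t v V)).
Proof.
move=> HF Ht; apply: (definable_in (K := fun v V => F (fun n => v n.+1) V)
  (t := fun v V => pr (t (fun n => v n.+1) V) (v 0))).
  by pd.
by apply: definable_term_pr; pd.
Qed.

Lemma definable_class_set0 : definable_class (fun _ _ => set0).
Proof. exact: definable_bot. Qed.

Lemma definable_class_setof (Q : M -> (nat -> M) -> (nat -> set M) -> Prop) :
  definable (fun v V => Q (v 0) (fun n => v n.+1) V) ->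
    definable_class (fun v V => [set x | Q x v V]).
Proof. by []. Qed.

(** In these names the digits count class and set arguments. The lemmas let [pd] use a definability
    hypothesis on an abstract predicate at arbitrary terms. *)
Lemma definable_app01 P t : definable (fun v V => P (v 0)) ->
  definable_term t ->
  definable (fun v V => P (t v V)).
Proof. by move=> H Ht; apply: (definable_mterm (Q := fun x v V => P x) Ht). Qed.

Lemma definable_app02 P t u : definable (fun v V => P (v 0) (v 1)) ->
  definable_term t -> definable_term u ->
  definable (fun v V => P (t v V) (u v V)).
Proof.
move=> H Ht Hu; apply: (definable_mterm (Q := fun x v V => P x (u v V)) Ht).
apply: (definable_mterm (Q := fun x v V => P (v 0) x) (definable_term_ren succn
  id Hu)).
exact: (definable_ren (fun n => if n is 0 then 1 else 0) id H).
Qed.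

Lemma definable_app10 P F : definable (fun v V => P (V 0)) ->
  definable_class F -> definable (fun v V => P (F v V)).
Proof. by move=> H HF; apply: (definable_cterm (Q := fun x v V => P x) HF). Qed.

Lemma definable_app11 P F t : definable (fun v V => P (V 0) (v 0)) ->
  definable_class F -> definable_term t ->
  definable (fun v V => P (F v V) (t v V)).
Proof.
move=> H HF Ht; apply: (definable_cterm (Q := fun x v V => P x (t v V)) HF).
exact: (definable_mterm (Q := fun x v V => P (V 0) x) (definable_term_ren id
  succn Ht)).
Qed.

Lemma definable_app12 P F t u : definable (fun v V => P (V 0) (v 0) (v 1)) ->
  definable_class F -> definable_term t -> definable_term u ->
  definable (fun v V => P (F v V) (t v V) (u v V)).
Proof.
move=> H HF Ht Hu; apply: (definable_cterm (Q := fun x v V => P x (t v V) (u v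
  V)) HF).
apply: (definable_mterm (Q := fun x v V => P (V 0) x (u v (fun n => V n.+1)))
  (definable_term_ren id succn Ht)).
apply: (definable_mterm (Q := fun x v V => P (V 0) (v 0) x) (definable_term_ren
  succn succn Hu)).
exact: (definable_ren (fun n => if n is 0 then 1 else 0) id H).
Qed.

Lemma definable_app22 P F G t u :
  definable (fun v V => P (v 0) (v 1) (V 0) (V 1)) ->
  definable_term t -> definable_term u -> definable_class F ->
    definable_class G ->
  definable (fun v V => P (t v V) (u v V) (F v V) (G v V)).
Proof.
move=> H Ht Hu HF HG.
apply: (definable_cterm (Q := fun x v V => P (t v V) (u v V) x (G v V)) HF).
apply: (definable_cterm (Q := fun x v V => P (t v (fun n => V n.+1))
  (u v (fun n => V n.+1)) (V 0) x) (definable_class_ren id succn HG)).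
have H' : definable (fun v V => P (v 0) (v 1) (V 1) (V 0)) :=
  definable_ren id (fun n => if n is 0 then 1 else 0) H.
apply: (definable_mterm (Q := fun x v V => P x (u v (fun n => V n.+2)) (V 1) (V
  0))
  (definable_term_ren id (fun n => n.+2) Ht)).
apply: (definable_mterm (Q := fun x v V => P (v 0) x (V 1) (V 0))
  (definable_term_ren succn (fun n => n.+2) Hu)).
exact: (definable_ren (fun n => if n is 0 then 1 else 0) id H').
Qed.

Lemma definable_app23 P F G t u w :
  definable (fun v V => P (v 0) (v 1) (v 2) (V 0) (V 1)) ->
  definable_term t -> definable_term u -> definable_term w ->
    definable_class F -> definable_class G ->
  definable (fun v V => P (t v V) (u v V) (w v V) (F v V) (G v V)).
Proof.
move=> H Ht Hu Hw HF HG.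
apply: (definable_cterm (Q := fun x v V => P (t v V) (u v V) (w v V) x (G v V))
  HF).
apply: (definable_cterm (Q := fun x v V => P (t v (fun n => V n.+1))
  (u v (fun n => V n.+1)) (w v (fun n => V n.+1)) (V 0) x) (definable_class_ren
    id succn HG)).
have H' : definable (fun v V => P (v 0) (v 1) (v 2) (V 1) (V 0)) :=
  definable_ren id (fun n => if n is 0 then 1 else 0) H.
apply: (definable_mterm (Q := fun x v V => P x (u v (fun n => V n.+2))
  (w v (fun n => V n.+2)) (V 1) (V 0)) (definable_term_ren id (fun n => n.+2)
    Ht)).
apply: (definable_mterm (Q := fun x v V => P (v 0) x
  (w (fun n => v n.+1) (fun n => V n.+2)) (V 1) (V 0))
  (definable_term_ren succn (fun n => n.+2) Hu)).
apply: (definable_mterm (Q := fun x v V => P (v 1) (v 0) x (V 1) (V 0))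
  (definable_term_ren (fun n => n.+2) (fun n => n.+2) Hw)).
exact: (definable_ren (fun n => if n is 0 then 2 else if n is 1 then 1 else 0)
  id H').
Qed.

End Comprehension.

Ltac dt_user ::=
  lazymatch goal with
  | |- definable_term _ _ (fun v V => pr _ _ _) => apply: definable_term_pr; dt
  | |- definable_term _ _ (fun v V => upr _ _ _) => apply: definable_term_upr;
    dt
  end.
Ltac dc_user ::=
  lazymatch goal with
  | |- definable_class _ _ (fun v V => sec _ _ _) => apply:
    definable_class_sec; [ dc | dt ]
  | |- definable_class _ _ (fun v V => set0) => apply: definable_class_set0
  | |- definable_class _ _ (fun v V => [set x | _]) => apply:
    definable_class_setof; pd
  end.
Ltac pd_hyp :=
  first [ lazymatch goal with
          | |- definable _ _ (fun v V => is_opair _ _ _ _) => apply: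
      definable_opair end
        | match goal with
          | H : definable _ _ (fun v V => ?P (v 0)) |- _ =>
              refine (definable_app01 (P := P) H _)
          | H : definable _ _ (fun v V => ?P (v 0) (v 1)) |- _ =>
              refine (definable_app02 (P := P) H _ _)
          | K : KM _ _, H : definable _ _ (fun v V => ?P (V 0)) |- _ =>
              refine (definable_app10 K (P := P) H _)
          | K : KM _ _, H : definable _ _ (fun v V => ?P (V 0) (v 0)) |- _ =>
              refine (definable_app11 K (P := P) H _ _)
          | K : KM _ _, H : definable _ _ (fun v V => ?P (V 0) (v 0) (v 1)) |-
      _ =>
              refine (definable_app12 K (P := P) H _ _ _)
          | K : KM _ _, H : definable _ _ (fun v V => ?P (v 0) (v 1) (V 0) (V
      1)) |- _ =>
              refine (definable_app22 K (P := P) H _ _ _ _)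
          | K : KM _ _, H : definable _ _ (fun v V => ?P (v 0) (v 1) (v 2) (V
      0) (V 1)) |- _ =>
              refine (definable_app23 K (P := P) H _ _ _ _ _)
          end ].

Ltac pd_user ::= pd_hyp.

(** * Recursion along well-founded class relations; absoluteness of well-foundedness *)

Section Recursion.
Variables (M : Type) (E : M -> M -> Prop) (Zf : ZF E) (X : set (set M)).
Hypothesis K : KM E X.
Notation definable := (definable E X).
Notation definable_class := (definable_class E X).
Notation pr := (pr Zf).
Notation sing := (sing Zf).

Lemma rel_ofE R x y : rel_of E R x y <-> R (pr x y).
Proof.
split=> [[p [/(opair_pr Zf) -> //]]|H].
by exists (pr x y); split=> //; apply/(opair_pr Zf).
Qed.

Definition is_set (Q : M -> Prop) := exists b, forall x, E x b <-> Q x.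

(** Class replacement is applied to the identity restricted to [A]. *)
Lemma class_sep A a : X A -> is_set (fun x => E x a /\ A x).
Proof.
move=> XA; pose F := [set p | exists x, A x /\ p = pr x x].
have XF : X F by apply: (class_comprehension K); pd.
have FE x y : rel_of E F x y <-> A x /\ x = y.
  rewrite rel_ofE; split=> [[z [Az /pr_inj[-> ->]]] //|[Ax <-]].
  by exists x.
have [|b Hb] := KM_class_replacement K XF _ a.
  split; last by move=> x y z /FE[_ <-] /FE[_ <-].
  by move=> p [x [_ ->]]; exists x, x; apply/(opair_pr Zf).
exists b => x; rewrite Hb; split=> [[y [yb /FE[Ay <-]]] //|[xa Ax]].
by exists x; rewrite FE.
Qed.

Lemma union_repl T a : definable (fun v V => T (v 0) (v 1)) ->
  (forall y, E y a -> is_set (T y)) ->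
  is_set (fun z => exists y, E y a /\ T y z).
Proof.
move=> HT Hs.
pose F := [set p | exists y s, p = pr y s /\ E y a /\ forall z, E z s <-> T y
  z].
have XF : X F by apply: (class_comprehension K); pd.
have FE x y : rel_of E F x y <-> E x a /\ forall z, E z y <-> T x z.
  rewrite rel_ofE; split=> [[y' [s [/pr_inj[-> ->]]]] //|H].
  by exists x, y.
have [|b Hb] := KM_class_replacement K XF _ a.
  split; last first.
    move=> x y z /FE[_ H1] /FE[_ H2].
    by apply: (ZF_extensionality Zf) => w; rewrite H1 H2.
  by move=> p [y [s [-> _]]]; exists y, s; apply/(opair_pr Zf).
have [u Hu] := ZF_union Zf b.
exists u => z; rewrite Hu; split.
  move=> [s [/Hb[y [ya /FE[_ H]]] /H Tz]]; by exists y.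
move=> [y [ya Tz]]; have [s Hs'] := Hs y ya.
exists s; rewrite Hs'; split=> //; rewrite Hb; exists y; split=> //.
by rewrite FE.
Qed.

Definition wfX (lt : M -> M -> Prop) := wf_for X lt.

Lemma wfX_ind lt (P : M -> Prop) : wfX lt ->
  definable (fun v V => P (v 0)) ->
  (forall x, (forall y, lt y x -> P y) -> P x) -> forall x, P x.
Proof.
move=> wf HP IH x; apply: contrapT => nPx.
have XA : X [set x | ~ P x] by apply: (class_comprehension K); pd.
have [|y [/= nPy Hy]] := wf _ XA; first by exists x.
by apply: nPy; apply: IH => z ltzy; apply: contrapT => /Hy.
Qed.

Section Rec.
Variables (lt : M -> M -> Prop) (Phi : set M -> M -> M -> Prop).
Hypothesis wf : wfX lt.
Hypothesis Hlt : definable (fun v V => lt (v 0) (v 1)).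
Hypothesis HPhi : definable (fun v V => Phi (V 0) (v 0) (v 1)).
Hypothesis local : forall S S' t,
  (forall s x, lt s t -> (S (pr s x) <-> S' (pr s x))) ->
  forall x, Phi S t x <-> Phi S' t x.

Definition rec_ok (U S : set M) :=
  (forall s t, U t -> lt s t -> U s) /\
  forall t x, U t -> (S (pr t x) <-> Phi S t x).

Lemma definable_rec_ok F G : definable_class F -> definable_class G ->
  definable (fun v V => rec_ok (F v V) (G v V)).
Proof. by move=> HF HG; rewrite /rec_ok; pd. Qed.

Lemma rec_agree U S U' S' : X U -> X S -> X U' -> X S' ->
  rec_ok U S -> rec_ok U' S' -> forall t, U t -> U' t ->
  forall x, S (pr t x) <-> S' (pr t x).
Proof.
move=> XU XS XU' XS' [Ud UP] [U'd U'P] t; move: t.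
apply: (wfX_ind wf) => [|t IH]; first by pd.
move=> Ut U't x; rewrite UP // U'P //.
by apply: local => s y least_in; apply: IH => //;
  [apply: Ud least_in|apply: U'd least_in].
Qed.

(** Partial solutions agree by [rec_agree], so by impredicative comprehension their union is a
    solution on the union of the domains. *)
Lemma rec_ex : exists S, X S /\ forall t x, S (pr t x) <-> Phi S t x.
Proof.
have PDok := definable_rec_ok.
pose U0 := [set t | exists U, X U /\ exists S, X S /\ (rec_ok U S /\ U t)].
pose S0 := [set p | exists t x, p = pr t x /\
  exists U, X U /\ exists S, X S /\ (rec_ok U S /\ U t /\ S p)].
have XU0 : X U0 by apply: (class_comprehension K);
  do !first [apply: PDok|pd|apply: definable_cex|apply: definable_and].
have XS0 : X S0.
  apply: (class_comprehension K); apply: definable_ex; apply: definable_ex;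
    apply: definable_and; first by pd.
  do !first [apply: PDok|pd|apply: definable_cex|apply: definable_and].
have S0E U S t x : X U -> X S -> rec_ok U S -> U t ->
    (S0 (pr t x) <-> S (pr t x)).
  move=> XU XS ok Ut; split.
    move=> [t' [x' [/pr_inj[<- _] [U' [XU' [S' [XS' [ok' [U't H]]]]]]]]].
    by apply/(rec_agree XU XS XU' XS' ok ok' Ut U't).
  by move=> H; exists t, x; split=> //; exists U; split=> //; exists S.
have ok0 : rec_ok U0 S0.
  split.
    move=> s t [U [XU [S [XS [[Ud UP] Ut]]]]] least_in; exists U; split=> //.
    by exists S; do !split=> //; apply: Ud least_in.
  move=> t x [U [XU [S [XS [ok Ut]]]]].
  have [Ud UP] := ok.
  rewrite (S0E U S) // UP //; apply: local => s y least_in.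
  by rewrite (S0E U S) //; apply: Ud least_in.
suff U0T t : U0 t by exists S0; split=> // t x; apply: (proj2 ok0).
move: t; apply: (wfX_ind wf) => [|t IH]; first by pd.
(* A least point [t] outside the common domain could be added to it, since all predecessors of [t]
   are inside. *)
apply: contrapT => nU0t.
pose U1 := [set s | U0 s \/ s = t].
pose S1 := [set p | exists s x, p = pr s x /\
   ((U0 s /\ S0 p) \/ (s = t /\ Phi S0 t x))].
have XU1 : X U1 by apply: (class_comprehension K); pd.
have XS1 : X S1 by apply: (class_comprehension K); pd.
have S1E s x : U0 s -> (S1 (pr s x) <-> S0 (pr s x)).
  move=> U0s; split=> [[s' [x' [/pr_inj[<- <-] [[]//|[st _]]]]]|H].
    by rewrite st in U0s.
  by exists s, x; split=> //; left.
have ok1 : rec_ok U1 S1.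
  split=> [s r [U0r|->] lsr|s x [U0s|->]].
  - by left; apply: (proj1 ok0) lsr.
  - by left; apply: IH.
  - rewrite S1E // (proj2 ok0) //; apply: local => r y lrs.
    by rewrite S1E //; apply: (proj1 ok0) lrs.
  - have -> : S1 (pr t x) <-> Phi S0 t x.
      split=> [[s' [x' [/pr_inj[<- <-] [[]//|[]//]]]]|H].
      by exists t, x; split=> //; right.
    by apply: local => r y lrt; rewrite S1E //; apply: IH.
apply: nU0t; exists U1; split=> //; exists S1; split=> //; split=> //.
by right.
Qed.

End Rec.

Lemma is_set_ext P Q : (forall x, P x <-> Q x) -> is_set P -> is_set Q.
Proof. by move=> PQ [b Hb]; exists b => x; rewrite Hb. Qed.

Lemma is_set_or P Q : is_set P -> is_set Q -> is_set (fun x => P x \/ Q x).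
Proof.
move=> [a Ha] [b Hb]; have [u Hu] := ZF_union Zf (upr Zf a b).
exists u => x; rewrite Hu -Ha -Hb; split.
  by move=> [y [/uprP[->|->]]]; [left|right].
by move=> [?|?]; [exists a|exists b]; split=> //; apply/uprP; [left|right].
Qed.

Lemma is_set1 a : is_set (fun x => x = a).
Proof. by exists (sing a) => x; apply: singP. Qed.

(** The closure is built in stages along an inductive set [w] ordered by [E]. Of [w] only closure
    under successors matters: it makes the union of the stages closed under [r]. *)
Lemma closure_set r x0 : definable (fun v V => r (v 0) (v 1)) ->
  (forall u, is_set (r u)) ->
  exists a, E x0 a /\ forall u z, E u a -> r u z -> E z a.
Proof.
move=> Hr rs; have [w [[e [_ ew]] ws]] := ZF_infinity Zf.
pose lt y x := E y x /\ E x w /\ E y w.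
have Hlt : definable (fun v V => lt (v 0) (v 1)) by rewrite /lt; pd.
have wf : wfX lt.
  move=> A XA [x Ax]; case: (pselect (exists y, A y /\ E y w)); last first.
    move=> H; exists x; split=> // y _ [_ [xw _]]; apply: H; by exists x.
  move=> [y [Ay yw]]; have [b Hb] := class_sep w XA.
  have [|z [/Hb[zw Az] Hz]] := ZF_foundation Zf (a := b).
    by exists y; apply/Hb.
  exists z; split=> // t At [tz [_ tw]]; apply: Hz; exists t; split=> //.
  exact/Hb.
pose Phi (S : set M) t x := x = x0 \/
  exists s, lt s t /\ (S (pr s x) \/ exists u, S (pr s u) /\ r u x).
have [||S [XS SE]] := rec_ex (Phi := Phi) wf Hlt.
- by rewrite /Phi; pd.
- move=> S S' t SS' x; rewrite /Phi; split=> -[|[s [least_in H]]]; try by left.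
    right; exists s; split=> //; move: H => [/SS'|]; first by left; auto.
    by move=> [u [/SS' H ?]]; right; exists u; split=> //; apply: H.
  right; exists s; split=> //; move: H => [/SS'|]; first by left; auto.
  by move=> [u [/SS' H ?]]; right; exists u; split=> //; apply: H.
have Sset t : E t w -> is_set (fun x => S (pr t x)).
  move: t; apply: (wfX_ind wf) => [|t IH tw]; first by rewrite /is_set; pd.
  pose T s x := E s w /\ (S (pr s x) \/ exists u, S (pr s u) /\ r u x).
  have : is_set (fun x => x = x0 \/ exists s, E s t /\ T s x).
    apply: is_set_or; first exact: is_set1.
    apply: union_repl; first by rewrite /T; pd.
    move=> s st; case: (pselect (E s w)) => sw; last first.
      by exists (emp Zf) => z; split=> [/empP//|[]].
    have [b Hb] := IH s (conj st (conj tw sw)) sw.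
    have : is_set (fun x => S (pr s x) \/ exists u, E u b /\ r u x).
      by apply: is_set_or; [exists b|apply: union_repl].
    apply: is_set_ext => x; rewrite /T.
    split=> [[?|[u [/Hb ? ?]]]|[_ [?|[u [/Hb ? ?]]]]]; auto.
    - by split=> //; right; exists u.
    - by right; exists u.
  apply: is_set_ext => x; rewrite SE /Phi /lt /T.
  split=> [[|[s [st [sw H]]]]|[|[s [[st [_ sw]] H]]]]; auto; right;
    exists s => //.
have [a Ha] : is_set (fun z => exists t, E t w /\ S (pr t z)).
  by apply: union_repl => //; pd.
exists a; split; first by apply/Ha; exists e; split=> //; apply/SE; left.
move=> u z /Ha[t [tw Stu]] ruz; apply/Ha.
have [s [Hs sw]] := ws t tw.
exists s; split=> //; apply/SE; right; exists t; split; last by right; exists u.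
by split=> //; apply/Hs; right.
Qed.

(** Foundation speaks of sets. The class is cut down to a set by closing one of its members under
    elements. *)
Lemma E_wf : wfX E.
Proof.
move=> A XA [x0 Ax0].
have [||a [x0a Ha]] := closure_set x0 (r := fun u z => E z u).
- by pd.
- by move=> u; exists u.
have [b Hb] := class_sep a XA.
have [|x [/Hb[xa Ax] Hx]] := ZF_foundation Zf (a := b).
  by exists x0; apply/Hb.
exists x; split=> // y Ay yx; apply: Hx; exists y; split=> //; apply/Hb.
by split=> //; apply: (Ha x).
Qed.

(* This makes well-foundedness in the sense of [(M, X)] independent of [X]. The
   class [S] below is a cumulative hierarchy indexed by all sets instead of
   ordinals, used for Scott's trick. *)
Lemma illfounded_set R A : definable (fun v V => R (v 0) (v 1)) -> X A ->
  A !=set0 -> (forall x, A x -> exists y, A y /\ R y x) ->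
  exists a, (exists x, E x a) /\
    forall x, E x a -> exists y, E y a /\ R y x.
Proof.
move=> HR XA [x0 Ax0] Hill.
pose Phi (S : set M) t x := exists s, E s t /\ forall z, E z x -> S (pr s z).
have HE : definable (fun v V => E (v 0) (v 1)) by pd.
have [||S [XS SE]] := rec_ex (Phi := Phi) E_wf HE.
- by rewrite /Phi; pd.
- move=> S S' t SS' x; rewrite /Phi.
  by split=> -[s [st H]]; exists s; split=> // z /H /SS'; apply.
have Sset t : is_set (fun x => S (pr t x)).
  move: t; apply: (wfX_ind E_wf) => [|t IH]; first by rewrite /is_set; pd.
  have : is_set (fun x => exists s, E s t /\ forall z, E z x -> S (pr s z)).
    apply: (union_repl (T := fun s x => forall z, E z x -> S (pr s z))).
      by pd.
    move=> s st; have [b Hb] := IH s st; have [p Hp] := ZF_powerset Zf b.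
    by exists p => x; rewrite Hp; split=> H z /H /Hb.
  by apply: is_set_ext => x; rewrite SE.
(* This comparability of levels replaces the linear order of the ordinals; with [E_wf] it yields a
   least level containing a candidate. *)
have lin t : forall t', (forall x, S (pr t x) -> S (pr t' x)) \/
   exists x, S (pr t x) /\ forall z, E z x <-> S (pr t' z).
  move: t; apply: (wfX_ind E_wf) => [|t IH t']; first by pd.
  case: (pselect (forall x, S (pr t x) -> S (pr t' x))); first by left.
  move=> /existsNP[z /not_implyP[/SE[s [st zs]] nz]]; right.
  have [b Hb] := Sset t'; exists b; split=> //; apply/SE; exists s; split=> //.
  move=> u /Hb /SE[s' [st' us']].
  have [H|[x [Sx Hx]]] := IH s st s'.
    by case: nz; apply/SE; exists s'; split=> // y /zs /H.
  move/SE: Sx => [r [rs Hr]]; apply/SE; exists r; split=> // y /us' /Hx /Hr //.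
have self t : S (pr (sing t) t).
  apply/SE; exists t; split; first exact/singP.
  move: t; apply: (wfX_ind E_wf) => [|t IH z zt]; first by pd.
  by apply/SE; exists z; split=> // u uz; apply: IH.
pose cand b t := exists y, A y /\ R y b /\ S (pr t y).
pose least b t := cand b t /\ forall t', cand b t' -> forall x, S (pr t x) ->
  S (pr t' x).
have Hcand : definable (fun v V => cand (v 0) (v 1)) by rewrite /cand; pd.
have Hleast : definable (fun v V => least (v 0) (v 1)) by rewrite /least; pd.
have leastP b : A b -> exists t, least b t.
  move=> Ab; have [y [Ay Ryb]] := Hill b Ab.
  pose Q := [set x | exists t, cand b t /\ forall z, E z x <-> S (pr t z)].
  have XQ : X Q by apply: (class_comprehension K); pd.
  have [|x [[t [ct tx]] Hx]] := E_wf XQ.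
    have [v Hv] := Sset (sing y); exists v, (sing y); split=> //.
    by exists y.
  exists t; split=> // t' ct'.
  have [//|[v [Sv Hv]]] := lin t t'.
  case: (Hx v); last exact/tx.
  by exists t'.
(* [r b] is the whole least level that has an [R]-predecessor of [b] in [A]. No choice is made, and
   being a set it is suitable for [closure_set]. *)
pose r b z := A b /\ exists t, least b t /\ S (pr t z).
have [||a [x0a Ha]] := closure_set x0 (r := r).
- by rewrite /r; pd.
- move=> b; case: (pselect (A b)) => Ab; last first.
    by exists (emp Zf) => z; split=> [/empP//|[]].
  have [t lt] := leastP b Ab; apply: is_set_ext (Sset t) => z.
  split=> [Stz|[_ [t' [[ct' lt'] H]]]]; first by split=> //; exists t.
  by apply: lt' H; apply: (proj1 lt).
have [b Hb] := class_sep a XA.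
exists b; split; first by exists x0; apply/Hb.
move=> x /Hb[xa Ax]; have [t lt] := leastP x Ax.
have [y [Ay [Ryx Sy]]] := proj1 lt.
exists y; split=> //; apply/Hb; split=> //; apply: (Ha x) => //.
by split=> //; exists t.
Qed.

Lemma wf_for_absolute Y R : KM E Y -> definable (fun v V => R (v 0) (v 1)) ->
  wf_for Y R -> wfX R.
Proof.
move=> KY HR wf A XA A0; apply: contrapT => H.
have [|a [a0 Ha]] := illfounded_set HR XA A0.
  move=> x Ax; apply: contrapT => H'; apply: H; exists x; split=> // y Ay Ryx.
  by apply: H'; exists y.
have [||x [/= xa Hx]] := wf [set x | E x a].
- by apply: (class_comprehension KY); pd.
- exact: a0.
- by have [y [ya Ryx]] := Ha x xa; apply: (Hx y ya).
Qed.

End Recursion.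

(** * Internal truth, canonical codes and good classes *)

Section Truth.
Variables (M : Type) (E : M -> M -> Prop) (Zf : ZF E) (X : set (set M)).
Notation definable := (definable E X).
Notation definable_term := (definable_term E X).
Notation definable_class := (definable_class E X).
Notation pr := (pr Zf).
Notation num := (num Zf).
Notation sec := (sec Zf).
Notation upd := (upd Zf).

Definition sec0 (Z : set M) (k : M) : set M := sec Z (pr (num 0) k).

Definition fam (Z : set M) : set (set M) := fun A => exists k, A = sec0 Z k.

(** As [fam set0] contains [set0], the class [B] is required to be nonempty; this makes [set0] the
    least good class instead of a class below itself. *)
Definition below (A B : set M) : Prop := (exists x, B x) /\ fam B A.

(* One step of the truth definition for [(M, F)]. A term [t] codes a formula
   with keyed set variables, whose values are given by the set [e] of pairs
   (key, value), and with two class registers holding [A1] and [A2]; a class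
   quantifier loads the first register and moves its old content to the second.
   Truth of subformulas is taken at the indices in [J]. *)
Definition gclause (I : Type) (J : I -> Prop) (F : set (set M))
    (s : I -> M -> M -> set M -> set M -> Prop) (t e : M) (A1 A2 : set M) :=
  (exists i j x y, t = pr (num 0) (pr i j) /\
     E (pr i x) e /\ E (pr j y) e /\ E x y) \/
  (exists i j x y, t = pr (num 1) (pr i j) /\
     E (pr i x) e /\ E (pr j y) e /\ A1 (pr x y)) \/
  (exists i j x y, t = pr (num 2) (pr i j) /\
     E (pr i x) e /\ E (pr j y) e /\ A2 (pr x y)) \/
  (exists u u', t = pr (num 3) (pr u u') /\
     forall m, J m -> ~ (s m u e A1 A2 /\ s m u' e A1 A2)) \/
  (exists i u, t = pr (num 4) (pr i u) /\
     forall m, J m -> forall y e', upd e i y e' -> s m u e' A1 A2) \/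
  (exists u, t = pr (num 5) u /\
     forall m, J m -> forall B, X B -> F B -> s m u e B A1).

(** One inductive step of the Tarski-Vaught test, the last hypothesis handling the class quantifier.
    The index types may differ, so that truth indexed by elements of [M] can be compared with truth
    indexed by natural numbers. *)
Lemma gclause_elem (I I' : Type) (J : I -> Prop) (J' : I' -> Prop)
    (F F' : set (set M)) s s' :
  F `<=` F' -> F' `<=` X ->
  (forall m, J m -> exists m', J' m' /\
     forall u e A B, F A -> F B -> (s m u e A B <-> s' m' u e A B)) ->
  (forall m', J' m' -> exists m, J m /\
     forall u e A B, F A -> F B -> (s m u e A B <-> s' m' u e A B)) ->
  (forall m u e A, J' m -> F A -> (exists B, F' B /\ ~ s' m u e B A) ->
     exists B, F B /\ ~ s' m u e B A) ->
  forall t e A1 A2, F A1 -> F A2 ->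
  (gclause J F s t e A1 A2 <-> gclause J' F' s' t e A1 A2).
Proof.
move=> FF' F'X H1 H2 TV t e A1 A2 F1 F2; rewrite /gclause.
have -> : (exists u u', t = pr (num 3) (pr u u') /\
     forall m, J m -> ~ (s m u e A1 A2 /\ s m u' e A1 A2)) <->
  (exists u u', t = pr (num 3) (pr u u') /\
     forall m, J' m -> ~ (s' m u e A1 A2 /\ s' m u' e A1 A2)).
  split=> -[u [u' [-> H]]]; exists u, u'; split=> // m Jm.
    have [m' [Jm' Hm]] := H2 m Jm; rewrite -!Hm //; exact: H.
  have [m' [Jm' Hm]] := H1 m Jm; rewrite !Hm //; exact: H.
have -> : (exists i u, t = pr (num 4) (pr i u) /\
     forall m, J m -> forall y e', upd e i y e' -> s m u e' A1 A2) <->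
  (exists i u, t = pr (num 4) (pr i u) /\
     forall m, J' m -> forall y e', upd e i y e' -> s' m u e' A1 A2).
  split=> -[i [u [-> H]]]; exists i, u; split=> // m Jm y e' Hu.
    have [m' [Jm' Hm]] := H2 m Jm; rewrite -Hm //; exact: (H m' Jm' y).
  have [m' [Jm' Hm]] := H1 m Jm; rewrite Hm //; exact: (H m' Jm' y).
have -> // : (exists u, t = pr (num 5) u /\
     forall m, J m -> forall B, X B -> F B -> s m u e B A1) <->
  (exists u, t = pr (num 5) u /\
     forall m, J' m -> forall B, X B -> F' B -> s' m u e B A1).
split=> -[u [-> H]]; exists u; split=> // m Jm B XB FB; last first.
  by have [m' [Jm' Hm]] := H1 m Jm; rewrite Hm //; apply: H => //; apply: FF'.
apply: contrapT => nB; have [m' [Jm' Hm]] := H2 m Jm.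
have [|C [FC]] := TV m u e A1 Jm F1; first by exists B.
by rewrite -Hm // => nC; apply: nC; apply: H => //; apply/F'X/FF'.
Qed.

Definition sigS (Z S : set M) (m u e : M) (A B : set M) :=
  exists k1 k2, A = sec0 Z k1 /\ B = sec0 Z k2 /\
    S (pr m (pr u (pr e (pr k1 k2)))).

(** The recursion is on the index [n] along [E], not on the term [t]. So nonstandard terms, and sets
    that code no term at all, do no harm. *)
Definition SatCls (Z S : set M) := forall n t e k1 k2,
  S (pr n (pr t (pr e (pr k1 k2)))) <->
  gclause (fun m => E m n) (fam Z) (sigS Z S) t e (sec0 Z k1) (sec0 Z k2).

Definition SatF (Z : set M) (n t e : M) (A B : set M) :=
  exists S, X S /\ (SatCls Z S /\ sigS Z S n t e A B).

(* The functions of which the canonical codes are hulls: [witness s d B A] says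
   that [B] is a witness for the instruction [d] with class parameter [A]. The
   first kind makes hulls elementary, the second makes them initial segments,
   the third gives comprehension. *)
Definition witness (s : M -> M -> M -> set M -> set M -> Prop) (d : M)
    (B A : set M) :=
  (exists n u e, d = pr (num 0) (pr n (pr u e)) /\ ~ s n u e B A) \/
  (exists m, d = pr (num 1) m /\ B = sec A m) \/
  (exists n u e, d = pr (num 2) (pr n (pr u e)) /\
     exists m, forall x,
       sec B m x <-> exists e', upd e (num 0) x e' /\ s n u e' A A).

Definition least_in (F P : set (set M)) (B : set M) :=
  F B /\ P B /\ forall B', X B' -> F B' -> P B' -> ~ below B' B.

(** The default [A0] also seeds the hull: [emp] is not a pair, hence names [A0]. *)
Definition hull_value (F : set (set M)) s (A0 : set M) (x : M) (B : set M)
    (a : M -> set M) :=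
  (exists d z, x = pr d z /\ least_in F (fun B => witness s d B (a z)) B) \/
  (~ (exists d z, x = pr d z /\
       exists B', X B' /\ (F B' /\ witness s d B' (a z))) /\ B = A0).

Definition hull_spec F s A0 (C : set M) :=
  forall x, hull_value F s A0 x (sec0 C x) (sec0 C).

(* [C] is the canonical code of [fam Z]: the names [(0, x)] list the hull of
   the empty class, the names [(1, _)] all classes definable over it. *)
Definition Code (Z C : set M) :=
  hull_spec (fam Z) (SatF Z) set0 C /\
  (forall n u e z y, C (pr (pr (num 1) (pr (pr n (pr u e)) z)) y) <->
     exists e', upd e (num 0) y e' /\ SatF Z n u e' (sec0 C z) (sec0 C z)) /\
  (forall p, C p -> (exists x y, p = pr (pr (num 0) x) y) \/
     exists n u e z y, p = pr (pr (num 1) (pr (pr n (pr u e)) z)) y).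

(** [Code C C] makes a good class determined by its family, as a von Neumann ordinal is by its
    elements; the other clauses are transitivity, linearity and well-foundedness, and the last one
    hands the structure down to the members. *)
Definition good (C : set M) := C = set0 \/
  ((exists x, C x) /\
   (forall A, X A -> forall B, X B -> fam C A -> below B A -> fam C B) /\
   (forall A, X A -> forall B, X B -> fam C A -> fam C B ->
      below A B \/ A = B \/ below B A) /\
   wf_for X (fun n m => below (sec0 C n) (sec0 C m)) /\
   Code C C /\
   forall A, X A -> fam C A -> A = set0 \/ (Code A A /\
     forall B, X B -> forall D, X D -> fam A B -> below D B -> fam A D)).

Definition goods : set (set M) := fun C => X C /\ good C.

Hypothesis K : KM E X.

Lemma definable_class_sec0 F t : definable_class F -> definable_term t ->
  definable_class (fun v V => sec0 (F v V) (t v V)).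
Proof. by move=> HF Ht; rewrite /sec0; pd. Qed.

Lemma sec_X A x : X A -> X (sec A x).
Proof. by move=> XA; apply: (class_comprehension K); rewrite /sec; pd. Qed.

Lemma fam_X Z A : X Z -> fam Z A -> X A.
Proof. by move=> XZ [k ->]; apply: sec_X. Qed.

Lemma definable_fam F A : definable_class F -> definable_class A ->
  definable (fun v V => fam (F v V) (A v V)).
Proof. by move=> HF HA; rewrite /fam /sec0; pd. Qed.

Lemma definable_below F A : definable_class F -> definable_class A ->
  definable (fun v V => below (F v V) (A v V)).
Proof. by move=> HF HA; rewrite /below /fam /sec0; pd. Qed.

Lemma definable_upd a b c d : definable_term a -> definable_term b ->
  definable_term c -> definable_term d ->
  definable (fun v V => upd (a v V) (b v V) (c v V) (d v V)).
Proof. by move=> Ha Hb Hc Hd; rewrite /upd; pd. Qed.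

Lemma definable_SatCls F A : definable_class F -> definable_class A ->
  definable (fun v V => SatCls (F v V) (A v V)).
Proof.
by move=> HF HA; rewrite /SatCls /gclause /sigS /fam /sec0 /upd; pd.
Qed.

Lemma definable_SatF F n t e A B : definable_class F -> definable_term n ->
  definable_term t -> definable_term e ->
  definable_class A -> definable_class B ->
  definable (fun v V => SatF (F v V) (n v V) (t v V) (e v V) (A v V) (B v V)).
Proof.
move=> HF Hn Ht He HA HB; rewrite /SatF /sigS /sec0.
apply: definable_cex; apply: definable_and; last by pd.
by apply: definable_SatCls; pd.
Qed.

End Truth.

Ltac dc_user ::=
  lazymatch goal with
  | |- definable_class _ _ (fun v V => sec _ _ _) => apply:
    definable_class_sec; [ dc | dt ]
  | |- definable_class _ _ (fun v V => sec0 _ _ _) => apply: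
    definable_class_sec0; [ dc | dt ]
  | |- definable_class _ _ (fun v V => set0) => apply: definable_class_set0
  | |- definable_class _ _ (fun v V => [set x | _]) => apply:
    definable_class_setof; pd
  end.

Ltac pd_sat :=
  lazymatch goal with
  | |- definable _ _ (fun v V => fam _ _ _) => apply: definable_fam
  | |- definable _ _ (fun v V => below _ _ _) => apply: definable_below
  | |- definable _ _ (fun v V => upd _ _ _ _ _) => apply: definable_upd
  | |- definable _ _ (fun v V => SatCls _ _ _ _) => apply: definable_SatCls
  | |- definable _ _ (fun v V => SatF _ _ _ _ _ _ _ _) => apply: definable_SatF
  end.
Ltac pd_user ::= first [ pd_sat | pd_hyp ].

(** * Truth classes, the Tarski-Vaught test and hulls *)

Section Theory.
Variables (M : Type) (E : M -> M -> Prop) (Zf : ZF E) (X : set (set M)).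
Hypothesis K : KM E X.
Notation definable := (definable E X).
Notation pr := (pr Zf).
Notation num := (num Zf).
Notation sec := (sec Zf).
Notation sing := (sing Zf).
Notation upd := (upd Zf).
Notation sec0 := (sec0 Zf).
Notation fam := (fam Zf).
Notation below := (below Zf).
Notation gclause := (gclause Zf X).
Notation sigS := (sigS Zf).
Notation SatCls := (SatCls Zf X).
Notation SatF := (SatF Zf X).
Notation witness := (witness Zf).
Notation least_in := (least_in Zf X).
Notation hull_value := (hull_value Zf X).

Lemma upd_ex e i y : exists e', upd e i y e'.
Proof.
have XA : X [set p | ~ exists z, p = pr i z] by apply: (class_comprehension K);
  pd.
exact: (is_set_or Zf (class_sep Zf K e XA) (is_set1 Zf (pr i y))).
Qed.

Lemma sat_ex Z : X Z -> exists S, X S /\ SatCls Z S.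
Proof.
move=> XZ; pose Phi S n x := exists t e k1 k2, x = pr t (pr e (pr k1 k2)) /\
  gclause (fun m => E m n) (fam Z) (sigS Z S) t e (sec0 Z k1) (sec0 Z k2).
have HE : definable (fun v V => E (v 0) (v 1)) by pd.
have [||S [XS SE]] := rec_ex (Zf := Zf) (Phi := Phi) K (E_wf Zf K) HE.
- by rewrite /Phi /gclause /sigS /fam /sec0 /upd; pd.
- move=> S S' n SS' x; rewrite /Phi.
  have aux S1 S2 : (forall s x, E s n -> (S1 (pr s x) <-> S2 (pr s x))) ->
      Phi S1 n x -> Phi S2 n x.
    move=> S12 [t [e [k1 [k2 [-> H]]]]]; exists t, e, k1, k2; split=> //.
    have agr m : E m n -> exists m', E m' n /\ forall u e A B, fam Z A ->
      fam Z B ->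
        (sigS Z S1 m u e A B <-> sigS Z S2 m' u e A B).
      move=> mn; exists m; split=> // u e' A B _ _.
      split=> -[a [b [-> [-> /S12 H']]]]; exists a, b; do 2!split=> //;
        exact: H'.
    have agr' m : E m n -> exists m', E m' n /\ forall u e A B, fam Z A ->
      fam Z B ->
        (sigS Z S1 m' u e A B <-> sigS Z S2 m u e A B).
      move=> mn; exists m; split=> // u e' A B _ _.
      split=> -[a [b [-> [-> /S12 H']]]]; exists a, b; do 2!split=> //;
        exact: H'.
    have famX : fam Z `<=` X by move=> A; apply: fam_X.
    have [k1Z k2Z] : fam Z (sec0 Z k1) /\ fam Z (sec0 Z k2).
      by split; [exists k1|exists k2].
    (* With both families equal to [fam Z], [gclause_elem] is just the congruence that the locality
       of the recursion asks for. *)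
    have := gclause_elem Zf (fun A (HA : fam Z A) => HA) famX agr agr'
      (fun m u e A _ _ HB => HB) t e k1Z k2Z.
    by move=> <-.
  by split; apply: aux => // s y sn; rewrite SS'.
exists S; split=> // n t e k1 k2; rewrite SE; split.
  by move=> [t' [e' [k1' [k2' [/pr_inj[-> /pr_inj[-> /pr_inj[-> ->]]]]]]]].
by move=> H; exists t, e, k1, k2.
Qed.

Lemma sigS_clause Z S n t e A B : SatCls Z S -> fam Z A -> fam Z B ->
  (sigS Z S n t e A B <->
   gclause (fun m => E m n) (fam Z) (sigS Z S) t e A B).
Proof.
move=> HS [k1 ->] [k2 ->]; split; last by move=> H; exists k1, k2; rewrite HS.
by move=> [a [b [-> [-> /HS]]]].
Qed.

(** The Tarski-Vaught test, by induction on the index. The predicate [s'] has to be definable for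
    this induction to be available in [X]. *)
Lemma SatF_elem_cls Z S F' s' : X Z -> X S -> SatCls Z S ->
  fam Z `<=` F' -> F' `<=` X ->
  definable (fun v V => s' (v 0) (v 1) (v 2) (V 0) (V 1)) ->
  (forall n t e A B, fam Z A -> fam Z B ->
     (s' n t e A B <-> gclause (fun m => E m n) F' s' t e A B)) ->
  (forall m u e A, fam Z A -> (exists B, F' B /\ ~ s' m u e B A) ->
     exists B, fam Z B /\ ~ s' m u e B A) ->
  forall n t e A B, fam Z A -> fam Z B ->
  (sigS Z S n t e A B <-> s' n t e A B).
Proof.
move=> XZ XS HS ZF' F'X Hs' s'E TV n.
suff: forall t e A, X A -> forall B, X B -> fam Z A -> fam Z B ->
    (sigS Z S n t e A B <-> s' n t e A B).
  by move=> H t e A B ZA ZB; apply: H => //; apply/F'X/ZF'.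
move: n; apply: (wfX_ind K (E_wf Zf K)) => [|n IH t e A XA B XB ZA ZB].
  by rewrite /sigS; pd.
rewrite sigS_clause // s'E //; apply: gclause_elem => //.
- move=> m mn; exists m; split=> // u e' A' B' ZA' ZB'.
  by apply: IH => //; apply/F'X/ZF'.
- move=> m mn; exists m; split=> // u e' A' B' ZA' ZB'.
  by apply: IH => //; apply/F'X/ZF'.
- by move=> m u e' A' _; apply: TV.
Qed.

(** Two truth classes for [Z] agree: this is the preceding test with [F'] taken to be [fam Z]. *)
Lemma SatF_sigS Z S n t e A B : X Z -> X S -> SatCls Z S ->
  fam Z A -> fam Z B -> (SatF Z n t e A B <-> sigS Z S n t e A B).
Proof.
move=> XZ XS HS ZA ZB; split; last by move=> H; exists S.
move=> [S' [XS' [HS' H]]].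
suff -> : sigS Z S n t e A B <-> sigS Z S' n t e A B by [].
apply: (SatF_elem_cls XZ XS HS (F' := fam Z)) => //.
- by move=> C; apply: fam_X.
- by rewrite /sigS; pd.
- by move=> *; apply: sigS_clause.
Qed.

Lemma SatFE Z n t e A B : X Z -> fam Z A -> fam Z B ->
  (SatF Z n t e A B <->
   gclause (fun m => E m n) (fam Z) (SatF Z) t e A B).
Proof.
move=> XZ ZA ZB; have [S [XS HS]] := sat_ex XZ.
rewrite (SatF_sigS _ _ _ XZ XS) // sigS_clause //.
apply: gclause_elem => //; first by move=> C; apply: fam_X.
- by move=> m mn; exists m; split=> // *; rewrite (SatF_sigS _ _ _ XZ XS).
- by move=> m mn; exists m; split=> // *; rewrite (SatF_sigS _ _ _ XZ XS).
Qed.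

Lemma SatF_elem Z F' s' : X Z ->
  fam Z `<=` F' -> F' `<=` X ->
  definable (fun v V => s' (v 0) (v 1) (v 2) (V 0) (V 1)) ->
  (forall n t e A B, fam Z A -> fam Z B ->
     (s' n t e A B <-> gclause (fun m => E m n) F' s' t e A B)) ->
  (forall m u e A, fam Z A -> (exists B, F' B /\ ~ s' m u e B A) ->
     exists B, fam Z B /\ ~ s' m u e B A) ->
  forall n t e A B, fam Z A -> fam Z B ->
  (SatF Z n t e A B <-> s' n t e A B).
Proof.
move=> XZ H1 H2 H3 H4 H5 n t e A B ZA ZB; have [S [XS HS]] := sat_ex XZ.
rewrite (SatF_sigS _ _ _ XZ XS) //.
exact: (SatF_elem_cls XZ XS HS H1 H2 H3 H4 H5).
Qed.

Lemma SatF_famE Z Z' : X Z -> X Z' -> fam Z = fam Z' ->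
  forall n t e A B, fam Z A -> fam Z B ->
  (SatF Z n t e A B <-> SatF Z' n t e A B).
Proof.
move=> XZ XZ' ZZ'; apply: (SatF_elem XZ (F' := fam Z')).
- by rewrite ZZ'.
- by move=> C; apply: fam_X.
- by pd.
- by rewrite ZZ' => n t e A B ZA ZB; apply: SatFE.
- by rewrite ZZ'.
Qed.

(** The index [sing n] looks at [n] only, and there the clause for nand is negation. This will bring
    elementarity at [sing n] down to [n]. *)
Lemma SatF_sing Z n u e A B : X Z -> fam Z A -> fam Z B ->
  (SatF Z (sing n) (pr (num 3) (pr u u)) e A B <-> ~ SatF Z n u e A B).
Proof.
move=> XZ ZA ZB; rewrite SatFE //; split.
  case=> [[i [j [x [y [/pr_inj[/num_inj //]]]]]]|].
  case=> [[i [j [x [y [/pr_inj[/num_inj //]]]]]]|].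
  case=> [[i [j [x [y [/pr_inj[/num_inj //]]]]]]|].
  case=> [[v [v' [/pr_inj[_ /pr_inj[-> ->]] H]]]|].
    by move=> H'; apply: (H n) => //; apply/singP.
  case=> [[i [v [/pr_inj[/num_inj //]]]]|[v [/pr_inj[/num_inj //]]]].
move=> H; do 3!right; left; exists u, u; split=> // m /singP ->.
by case.
Qed.

(** The hull recursion computes the value at [pr d z] from the value at [z], so it runs along this
    relation. *)
Lemma pr_wf : wfX X (fun z x => exists d, x = pr d z).
Proof.
move=> A XA [x0 Ax0].
(* The sets with an element in [A] are added to [A]: among them is the unordered pair [upr Zf d z],
   which lies between [z] and [pr d z]. *)
have XB : X [set y | A y \/ exists a, A a /\ E a y] by apply:
  (class_comprehension K); pd.
have [|y [/= By Hy]] := E_wf Zf K XB; first by exists x0; left.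
have Ay : A y by case: By => // -[a [Aa ay]]; case: (Hy a) => //; left.
exists y; split=> // z Az [d yE]; apply: (Hy (upr Zf d z)).
  by right; exists z; split=> //; apply/uprP; right.
by rewrite yE; apply/uprP; right.
Qed.

Definition linear_fam (F : set (set M)) :=
  forall A B, F A -> F B -> below A B \/ A = B \/ below B A.

Lemma least_in_uniq F P B B' : F `<=` X -> linear_fam F ->
  least_in F P B -> least_in F P B' -> B = B'.
Proof.
move=> FX lin [FB [PB HB]] [FB' [PB' HB']].
case: (lin B B' FB FB') => [bl|[//|bl]].
  by case: (HB' B) => //; apply: FX.
by case: (HB B') => //; apply: FX.
Qed.

Section Hull.
Variables (F : set (set M)) (s : M -> M -> M -> set M -> set M -> Prop).
Variable A0 : set M.
Hypothesis FX : F `<=` X.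
Hypothesis HF : definable (fun v V => F (V 0)).
Hypothesis Hs : definable (fun v V => s (v 0) (v 1) (v 2) (V 0) (V 1)).
Hypothesis FA0 : F A0.
Hypothesis lin : linear_fam F.
Hypothesis least_ex : forall P, definable (fun v V => P (V 0)) ->
  (exists B, F B /\ P B) -> exists B, least_in F P B.

Lemma hull_value_uniq a x B B' : hull_value F s A0 x B a ->
  hull_value F s A0 x B' a -> B = B'.
Proof.
move=> [[d [z [-> lB]]]|[nx ->]] [[d' [z' [xE lB']]]|[nx' ->]] //.
- by move/pr_inj: xE => [? ?]; subst d' z';
  apply: (least_in_uniq FX lin lB lB').
- case: nx'; exists d, z; split=> //; exists B; case: lB => FB [? _].
  by split; first exact: FX.
- case: nx; exists d', z'; split=> //; exists B'; case: lB' => FB [? _].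
  by split; first exact: FX.
Qed.

Lemma hull_value_ex (a : M -> set M) x : (forall z, X (a z)) ->
  exists B, hull_value F s A0 x B a.
Proof.
move=> Xa.
case: (pselect (exists d z, x = pr d z /\
       exists B', X B' /\ (F B' /\ witness s d B' (a z)))).
  move=> [d [z [-> [B' [_ [FB' pB']]]]]].
  have [||B lB] := least_ex (P := fun B => witness s d B (a z)).
  - by have Xaz := Xa z; rewrite /witness; pd.
  - by exists B'.
  by exists B; left; exists d, z.
by move=> H; exists A0; right.
Qed.

Lemma hull_value_loc a a' x B :
  (forall z, (exists d, x = pr d z) -> a z = a' z) ->
  hull_value F s A0 x B a -> hull_value F s A0 x B a'.
Proof.
move=> aa' [[d [z [xE lB]]]|[nx ->]].
  by left; exists d, z; rewrite -aa'; last by exists d.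
right; split=> // -[d [z [xE H]]]; apply: nx; exists d, z.
by rewrite aa'; last by exists d.
Qed.

Lemma hull_value_fam a x B : hull_value F s A0 x B a -> F B.
Proof. by move=> [[d [z [_ []]]]|[_ ->]]. Qed.

Lemma hull_ex : exists S, X S /\ forall x, hull_value F s A0 x (sec S x) (sec
  S).
Proof.
have XA0 : X A0 by apply: FX.
pose Phi S x y := exists B, X B /\ (hull_value F s A0 x B (sec S) /\ B y).
have Hlt : definable (fun v V => exists d, v 1 = pr d (v 0)) by pd.
have [||S [XS SE]] := rec_ex (Zf := Zf) (Phi := Phi) K pr_wf Hlt.
- by rewrite /Phi /hull_value /least_in /witness; pd.
- have aux S S' t : (forall z x, (exists d, t = pr d z) ->
      (S (pr z x) <-> S' (pr z x))) -> forall x, Phi S t x -> Phi S' t x.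
    move=> SS' x [B [XB [vB Bx]]]; exists B; do 2!split=> //.
    apply: hull_value_loc vB => z zt; apply/seteqP; split=> y; rewrite /sec;
    by apply SS'.
  by move=> S S' t SS' x; split; apply: aux => // z y zt; rewrite SS'.
exists S; split=> // x.
have [B vB] := hull_value_ex x (fun z => sec_X Zf K z XS).
suff -> : sec S x = B by [].
apply/seteqP; split=> y.
  by move=> /SE[B' [XB' [vB' By]]]; rewrite (hull_value_uniq vB vB').
by move=> By; apply/SE; exists B; split; first exact/FX/(hull_value_fam vB).
Qed.

End Hull.

End Theory.

(** * Uniqueness of codes and comparability of good classes *)

Section Codes.
Variables (M : Type) (E : M -> M -> Prop) (Zf : ZF E) (X : set (set M)).
Hypothesis K : KM E X.
Notation definable := (definable E X).
Notation pr := (pr Zf).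
Notation num := (num Zf).
Notation sing := (sing Zf).
Notation sec0 := (sec0 Zf).
Notation fam := (fam Zf).
Notation below := (below Zf).
Notation SatF := (SatF Zf X).
Notation witness := (witness Zf).
Notation least_in := (least_in Zf X).
Notation hull_value := (hull_value Zf X).
Notation hull_spec := (hull_spec Zf X).
Notation Code := (Code Zf X).
Notation goods := (goods Zf X).
Notation linear_fam := (linear_fam Zf).

Lemma witness_ext s s' d A B :
  (forall n u e, s n u e B A <-> s' n u e B A) ->
  (forall n u e, s n u e A A <-> s' n u e A A) ->
  witness s d B A -> witness s' d B A.
Proof.
move=> H1 H2 [[n [u [e [-> H]]]]|[H|[n [u [e [-> [m H]]]]]]].
- by left; exists n, u, e; rewrite -H1.
- by right; left.
- right; right; exists n, u, e; split=> //; exists m => x; rewrite H.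
  by split=> -[e' [? ?]]; exists e'; split=> //; apply/H2.
Qed.

Lemma emp_not_pr d z : emp Zf <> pr d z.
Proof.
move=> H; apply: (@empP _ _ Zf (sing d)); rewrite H; apply/uprP; by left.
Qed.

Lemma hull_spec_fam0 F s A0 C : hull_spec F s A0 C -> sec0 C (emp Zf) = A0.
Proof. by move=> /(_ (emp Zf)) [[d [z [/emp_not_pr]]]|[]]. Qed.

Lemma hull_spec_fam F s A0 C x : F A0 -> hull_spec F s A0 C -> F (sec0 C x).
Proof. by move=> F0 /(_ x) [[d [z [_ []]]]|[_ ->]]. Qed.

(** By induction on names, as least witnesses are unique in a linear family and both truth
    predicates agree on it. *)
Lemma hull_spec_uniq Z Z' C C' : X Z -> X Z' -> X C -> X C' -> fam Z = fam Z' ->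
  linear_fam (fam Z) -> fam Z set0 ->
  hull_spec (fam Z) (SatF Z) set0 C -> hull_spec (fam Z') (SatF Z') set0 C' ->
  forall x, sec0 C x = sec0 C' x.
Proof.
move=> XZ XZ' XC XC' ZZ' lin Z0 HC HC'.
have ZC x : fam Z (sec0 C x) by apply: hull_spec_fam HC.
have satE := SatF_famE K XZ XZ' ZZ'.
have famX : fam Z `<=` X by move=> A; apply: fam_X.
apply: (wfX_ind K (pr_wf Zf K)) => [|x IH]; first by pd.
apply: (@hull_value_uniq _ _ Zf X (fam Z) (SatF Z) set0 famX lin (sec0 C) x _ _
  (HC x)).
have {}HC' : hull_value (fam Z) (SatF Z') set0 x (sec0 C' x) (sec0 C).
  rewrite ZZ'; apply: (hull_value_loc (a := sec0 C')) (HC' x).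
  by move=> z zx; rewrite IH.
case: HC' => [[d [z [xE [ZB [pB HB]]]]]|[nx ->]].
  left; exists d, z; split=> //; split=> //; split.
    by apply: witness_ext pB => n u e; rewrite satE.
  move=> B' XB' ZB' pB'; apply: HB => //.
  by apply: witness_ext pB' => n u e; rewrite satE.
right; split=> // -[d [z [xE [B' [XB' [ZB' pB']]]]]]; apply: nx.
exists d, z; split=> //; exists B'; do 2!split=> //.
by apply: witness_ext pB' => n u e; rewrite satE.
Qed.

(** The first two clauses of [Code] determine the sections at names of the two shapes, and the third
    excludes any further elements. *)
Lemma code_uniq Z Z' C C' : X Z -> X Z' -> X C -> X C' -> fam Z = fam Z' ->
  linear_fam (fam Z) -> fam Z set0 -> Code Z C -> Code Z' C' -> C = C'.
Proof.
move=> XZ XZ' XC XC' ZZ' lin Z0 [HC [HC1 HC2]] [HC' [HC1' HC2']].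
have secE := hull_spec_uniq XZ XZ' XC XC' ZZ' lin Z0 HC HC'.
have satE := SatF_famE K XZ XZ' ZZ'.
have ZC x : fam Z (sec0 C x) by apply: hull_spec_fam HC.
apply/seteqP; split=> p Cp.
  case: (HC2 p Cp) => [[x [y pE]]|[n [u [e [z [y pE]]]]]]; subst p.
    by change (sec0 C' x y); rewrite -secE.
  move: Cp; rewrite HC1 HC1' -!secE => -[e' [? ?]]; exists e'; split=> //.
  by apply/satE.
case: (HC2' p Cp) => [[x [y pE]]|[n [u [e [z [y pE]]]]]]; subst p.
  by change (sec0 C x y); rewrite secE.
move: Cp; rewrite HC1 HC1' -!secE => -[e' [? ?]]; exists e'; split=> //.
by apply/satE.
Qed.

Lemma code_nonempty Z C : X Z -> fam Z set0 -> Code Z C -> exists x, C x.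
Proof.
move=> XZ Z0 [HC [HC1 _]].
(* At index [emp] the clause for nand is vacuously true, so this element lies in a definable class
   that is the whole universe. *)
pose a := emp Zf; exists (pr (pr (num 1) (pr (pr a (pr (pr (num 3) (pr a a))
  a)) a)) a).
apply/HC1; have [e' He'] := upd_ex Zf K a (num 0) a; exists e'; split=> //.
apply/SatFE => //; try by apply: hull_spec_fam HC.
do 3!right; left; exists a, a; split=> // m /empP [].
Qed.

Lemma nex_set0 (C : set M) : ~ (exists x, C x) -> C = set0.
Proof. by move=> H; apply/seteqP; split=> y // Ay; case: H; exists y. Qed.

Lemma good_set0 : goods set0.
Proof. by split; [apply: (class_comprehension K); pd|left]. Qed.

Lemma good_fam0 C : goods C -> (exists x, C x) -> fam C set0.
Proof.
move=> [XC [->|[_ [_ [_ [_ [[HC _] _]]]]]]] C0; first by case: C0.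
by exists (emp Zf); rewrite (hull_spec_fam0 HC).
Qed.

Lemma below0 A : ~ below A set0.
Proof. by move=> [[x]]. Qed.

Lemma good_fam C A : goods C -> (exists x, C x) -> fam C A -> goods A.
Proof.
move=> [XC [-> [x []]//|[_ [g1 [g2 [g3 [g4 g5]]]]]]] C0 CA.
have XA : X A by apply: fam_X CA.
split=> //; case: (g5 A XA CA) => [->|[cA tA]]; first by left.
right; case: (pselect (exists x, A x)) => A0; last first.
  case: (A0); have := nex_set0 A0 => {}A0.
  subst A; have Z0 : fam set0 set0 by exists (emp Zf).
  exact: (code_nonempty XA Z0 cA).
have AC B : fam A B -> fam C B.
  by move=> AB; apply: (g1 A) => //; apply: fam_X AB.
split=> //; split=> //; split.
  by move=> B XB D XD AB AD; apply: g2 => //; apply: AC.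
split; last by split=> // B XB /AC; apply: g5.
move=> Q XQ [n0 Qn0].
(* Well-foundedness passes from [C] to [A] by translating names: [Q'] has the names in [C] of the
   classes that [Q] names in [A]. *)
pose Q' := [set m | exists n, Q n /\ sec0 C m = sec0 A n].
have XQ' : X Q' by apply: (class_comprehension K); pd.
have [|m [[n [Qn mn]] Hm]] := g3 Q' XQ'.
  have [m mE] : fam C (sec0 A n0) by apply: AC; exists n0.
  by exists m, n0.
exists n; split=> // n' Qn' bl.
have [m' mE] : fam C (sec0 A n') by apply: AC; exists n'.
by apply: (Hm m'); [exists n'|rewrite -mE mn].
Qed.

Lemma good_below C A : goods C -> below A C -> goods A.
Proof. by move=> GC [C0 CA]; apply: good_fam CA. Qed.

Lemma good_trans C A B : goods C -> below A C -> below B A -> below B C.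
Proof.
move=> [XC [-> /below0 //|[C0 [g1 _]]]] [_ CA] bl; split=> //.
have XA : X A by apply: fam_X CA.
by apply: (g1 A) => //; apply: fam_X (proj2 bl).
Qed.

(** Either [B] itself is least, or a least class is found among its sections, which are well founded
    by goodness. *)
Lemma good_least (F P : set (set M)) : F `<=` goods ->
  definable (fun v V => F (V 0)) -> definable (fun v V => P (V 0)) ->
  (exists B, F B /\ P B) -> exists B, least_in F P B.
Proof.
move=> FG HF HP [B [FB PB]]; have GB := FG _ FB.
case: (GB) => XB [B0|[B0 [g1 [g2 [g3 _]]]]].
  by subst B; exists set0; do 2!split=> //; move=> B' _ _ _ /below0.
pose Q := [set n | F (sec0 B n) /\ P (sec0 B n)].
have XQ : X Q by apply: (class_comprehension K); pd.
case: (pselect (exists n, Q n)) => Q0; last first.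
  exists B; split=> //; split=> // B' XB' FB' PB' [_ [n nE]].
  by apply: Q0; exists n; rewrite /Q /= -nE.
have [n [[Fn Pn] Hn]] := g3 Q XQ Q0.
exists (sec0 B n); do 2!split=> //; move=> B' XB' FB' PB' bl.
have [m mE] : fam B B'.
  by apply: (g1 (sec0 B n)) => //; [apply: sec_X|exists n].
by apply: (Hn m); rewrite /Q /= -mE.
Qed.

Lemma good_linear C : goods C -> (exists x, C x) -> linear_fam (fam C).
Proof.
move=> [XC [-> [x []]//|[_ [_ [g2 _]]]]] _ A B CA CB.
by apply: g2 => //; [exact: fam_X CA|exact: fam_X CB].
Qed.

Lemma good_code C : goods C -> (exists x, C x) -> Code C C.
Proof. by move=> [XC [-> [x []]|[_ [_ [_ [_ [g4 _]]]]]]]. Qed.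

(** [A'] is the least member of [fam A] outside [fam B], as with the difference of two ordinals. *)
Lemma good_notsub A B : goods A -> goods B -> (exists x, A x) ->
  (exists x, B x) ->
  ~ fam A `<=` fam B ->
  exists A', [/\ fam A A', ~ fam B A', exists x, A' x &
     fam A' = fam A `&` fam B].
Proof.
move=> GA GB A0 B0 nAB; have [XA _] := GA; have [XB _] := GB.
have [||||A' [AA' [nBA' HA']]] := @good_least (fam A) (fun C => ~ fam B C).
- by move=> C; apply: good_fam.
- by pd.
- by pd.
- by apply: contrapT => H; apply: nAB => C AC; apply: contrapT => nBC;
     apply: H; exists C.
exists A'; have A'0 : exists x, A' x.
  apply: contrapT => H; apply: nBA'.
  have -> := nex_set0 H.
  exact: good_fam0.
split=> //; apply/seteqP; split=> [J A'J|J [AJ BJ]].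
  have AJ : fam A J by have [] : below J A by apply: (good_trans (A := A')).
  split=> //; apply: contrapT => nBJ; apply: (HA' J) => //.
  exact: fam_X AJ.
case: (good_linear GA A0 AJ AA') => [[]//|[JA'|A'J]].
  by rewrite JA' in BJ.
case: nBA'; have [] // : below A' B by apply: (good_trans (A := J)).
Qed.

Lemma good_famI A B : goods A -> goods B -> (exists x, A x) ->
  (exists x, B x) ->
  fam A = fam B -> A = B.
Proof.
move=> GA GB A0 B0 AB; have [XA _] := GA; have [XB _] := GB.
apply: (code_uniq XA XB XA XB AB).
- exact: good_linear.
- exact: good_fam0.
- exact: good_code.
- exact: good_code.
Qed.

(** The argument for ordinals: if neither family included the other, the least members outside would
    both have the intersection as family, so they would be equal and belong to both. *)
Lemma good_compare : linear_fam goods.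
Proof.
move=> A B GA GB.
have e0 := nex_set0.
case: (pselect (exists x, A x)) => [A0|/e0 ->]; last first.
  case: (pselect (exists x, B x)) => [B0|/e0 ->]; last by right; left.
  by left; split=> //; apply: good_fam0.
case: (pselect (exists x, B x)) => [B0|/e0 ->]; last first.
  by right; right; split=> //; apply: good_fam0.
case: (pselect (fam A `<=` fam B)) => AB;
  case: (pselect (fam B `<=` fam A)) => BA.
- by right; left; apply: good_famI => //; apply/seteqP.
- have [B' [BB' nAB' B'0 B'E]] := good_notsub GB GA B0 A0 BA.
  left; split=> //; suff -> : A = B' by [].
  apply: good_famI => //; first exact: good_fam BB'.
  by rewrite B'E; apply/seteqP; split=> C; [split=> //; apply: AB|case].
- have [B' [BB' nAB' B'0 B'E]] := good_notsub GA GB A0 B0 AB.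
  right; right; split=> //; suff -> : B = B' by [].
  apply: good_famI => //; first exact: good_fam BB'.
  by rewrite B'E; apply/seteqP; split=> C; [split=> //; apply: BA|case].
- have [B' [BB' nAB' B'0 B'E]] := good_notsub GB GA B0 A0 BA.
  have [A' [AA' nBA' A'0 A'E]] := good_notsub GA GB A0 B0 AB.
  case: nAB'; suff -> : B' = A' by [].
  apply: good_famI => //; [exact: good_fam BB'|exact: good_fam AA'|].
  by rewrite B'E A'E setIC.
Qed.

End Codes.

(** * Existence and condensation of canonical codes *)

Section Hulls.
Variables (M : Type) (E : M -> M -> Prop) (Zf : ZF E) (X : set (set M)).
Hypothesis K : KM E X.
Notation pr := (pr Zf).
Notation num := (num Zf).
Notation sec := (sec Zf).
Notation upd := (upd Zf).
Notation sec0 := (sec0 Zf).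
Notation fam := (fam Zf).
Notation below := (below Zf).
Notation SatF := (SatF Zf X).
Notation witness := (witness Zf).
Notation hull_spec := (hull_spec Zf X).
Notation Code := (Code Zf X).
Notation goods := (goods Zf X).

Lemma witness0 s n u e A B : witness s (pr (num 0) (pr n (pr u e))) B A <-> ~ s
  n u e B A.
Proof.
split; last by left; exists n, u, e.
case=> [[n' [u' [e' [/pr_inj[_ /pr_inj[-> /pr_inj[-> ->]]]]]]]//|].
by case=> [[m [/pr_inj[/num_inj]]]|[n' [u' [e' [/pr_inj[/num_inj]]]]]].
Qed.

Lemma witness1 s m A B : witness s (pr (num 1) m) B A <-> B = sec A m.
Proof.
split; last by right; left; exists m.
case=> [[n' [u' [e' [/pr_inj[/num_inj]]]]]//|].
by case=> [[m' [/pr_inj[_ ->]]]|[n' [u' [e' [/pr_inj[/num_inj]]]]]].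
Qed.

Lemma witness2 s n u e A B : witness s (pr (num 2) (pr n (pr u e))) B A <->
  exists m, forall x,
    sec B m x <-> exists e', upd e (num 0) x e' /\ s n u e' A A.
Proof.
split; last by right; right; exists n, u, e.
case=> [[n' [u' [e' [/pr_inj[/num_inj]]]]]//|].
case=> [[m' [/pr_inj[/num_inj]]]//|].
by move=> [n' [u' [e' [/pr_inj[_ /pr_inj[-> /pr_inj[-> ->]]]]]]].
Qed.

Lemma hull_spec_wit F s A0 C d z B : F `<=` X -> hull_spec F s A0 C -> F B ->
  witness s d B (sec0 C z) -> witness s d (sec0 C (pr d z)) (sec0 C z).
Proof.
move=> FX HC FB pB; case: (HC (pr d z)) => [[d' [z' [/pr_inj[-> ->] [_
  []]]]]//|].
move=> [[]]; exists d, z; split=> //; exists B; split=> //; exact: FX.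
Qed.

Definition chain (Z : set M) :=
  [/\ X Z, fam Z `<=` goods, fam Z set0 &
      forall A B, fam Z A -> below B A -> fam Z B].

(** The purpose of the second kind of instruction: what lies below a class of the hull is one of its
    sections, and the instruction names that section. *)
Lemma hull_spec_closed F s A0 C A B : F `<=` X ->
  (forall A B, F A -> below B A -> F B) -> F A0 ->
  hull_spec F s A0 C -> fam C A -> below B A -> fam C B.
Proof.
move=> FX Fdc F0 HC [z ->] bl; have FB : F B.
  by apply: Fdc bl; apply: hull_spec_fam HC.
have [_ [m mE]] := bl.
have pB : witness s (pr (num 1) (pr (num 0) m)) B (sec0 C z) by apply/witness1.
have /witness1 wE := hull_spec_wit FX HC FB pB.
by exists (pr (pr (num 1) (pr (num 0) m)) z); rewrite wE.
Qed.

Lemma hull_spec_TV F s A0 C m u e A : F `<=` X -> hull_spec F s A0 C ->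
  fam C A ->
  (exists B, F B /\ ~ s m u e B A) -> exists B, fam C B /\ ~ s m u e B A.
Proof.
move=> FX HC [z ->] [B [FB nB]].
have pB : witness s (pr (num 0) (pr m (pr u e))) B (sec0 C z) by apply/witness0.
have /witness0 w := hull_spec_wit FX HC FB pB.
by exists (sec0 C (pr (pr (num 0) (pr m (pr u e))) z)); split=> //; eexists.
Qed.

Lemma code_ex Z : chain Z -> exists C, X C /\ Code Z C.
Proof.
move=> [XZ ZG Z0 Zdc].
have famX : fam Z `<=` X by move=> A; apply: fam_X.
have [||||S [XS HS]] := hull_ex (Zf := Zf) (F := fam Z) (s := SatF Z) K famX _
  _ Z0.
- by pd.
- by pd.
- by move=> A B ZA ZB; apply: (good_compare K); apply: ZG.
- by move=> P HP H; apply: (good_least K (F := fam Z)) => //; pd.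
pose C := [set p | (exists x y, p = pr (pr (num 0) x) y /\ S (pr x y)) \/
  exists n u e z y, p = pr (pr (num 1) (pr (pr n (pr u e)) z)) y /\
    exists e', upd e (num 0) y e' /\ SatF Z n u e' (sec S z) (sec S z)].
have XC : X C by apply: (class_comprehension K); pd.
have CE x : sec0 C x = sec S x.
  apply/seteqP; split=> y.
    case=> [[x' [y' [/pr_inj[/pr_inj[_ ->] ->]]]]//|].
    by move=> [n [u [e [z [y' [/pr_inj[/pr_inj[/num_inj]]]]]]]].
  by move=> Sy; left; exists x, y.
exists C; split=> //; split; last split.
- by move=> x; rewrite CE; apply: hull_value_loc (HS x) => z _.
- move=> n u e z y; rewrite CE; split; last by move=> H; right;
  exists n, u, e, z, y.
  case=> [[x' [y' [/pr_inj[/pr_inj[/num_inj]]]]]//|].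
  move=> [n' [u' [e' [z' [y' []]]]]].
  by move=> /pr_inj[/pr_inj[_ /pr_inj[/pr_inj[-> /pr_inj[-> ->]] ->]] ->].
- move=> p [[x [y [-> _]]]|[n [u [e [z [y [-> _]]]]]]].
    by left; exists x, y.
  by right; exists n, u, e, z, y.
Qed.

(** Condensation. The hull is an elementary initial segment of [fam Z], so least witnesses computed
    in it are those computed in [fam Z]; hence [C] is also the code of its own family, and good. *)
Lemma code_hull Z C : chain Z -> X C -> Code Z C ->
  [/\ fam C `<=` fam Z, goods C, (exists x, C x),
      (forall n t e A B, fam C A -> fam C B ->
         (SatF C n t e A B <-> SatF Z n t e A B)) &
      fam C = fam Z \/ fam Z C].
Proof.
move=> [XZ ZG Z0 Zdc] XC cC; have [HC [HC1 HC2]] := cC.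
have famX : fam Z `<=` X by move=> A; apply: fam_X.
have CZ : fam C `<=` fam Z by move=> A [k ->]; apply: hull_spec_fam HC.
have C0 : exists x, C x by apply: code_nonempty cC.
have C00 : fam C set0 by exists (emp Zf); rewrite (hull_spec_fam0 HC).
have Cdc A B : fam C A -> below B A -> fam C B by apply: hull_spec_closed HC.
have satE : forall n t e A B, fam C A -> fam C B ->
     (SatF C n t e A B <-> SatF Z n t e A B).
  apply: (SatF_elem K XC CZ famX).
  - by pd.
  - by move=> n t e A B /CZ ? /CZ ?; apply: SatFE.
  - by move=> m u e A; apply: hull_spec_TV HC.
have FC x : fam C (sec0 C x) by exists x.
have pE d B z : fam C B ->
  (witness (SatF C) d B (sec0 C z) <-> witness (SatF Z) d B (sec0 C z)).
  by move=> CB; split; apply: witness_ext => n u e; rewrite satE.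
have cCC : Code C C.
  split; last split=> //.
    move=> x; case: (HC x) => [[d [z [xE [_ [pB HB]]]]]|[nx ->]].
      left; exists d, z; split=> //; split=> //; split; first exact/pE.
      by move=> B' XB' CB' /(pE _ _ _ CB'); apply: HB => //; apply: CZ.
    right; split=> // -[d [z [xE [B' [XB' [CB' pB']]]]]]; apply: nx.
    exists d, z; split=> //; exists B'; split=> //; split; first exact: CZ.
    exact/pE.
  move=> n u e z y; rewrite HC1.
  by split=> -[e' [? ?]]; exists e'; split=> //; apply/satE.
have CG A : fam C A -> goods A by move=> /CZ; apply: ZG.
have GC : goods C.
  split=> //; right; split=> //; split; first by move=> A XA B XB; apply: Cdc.
  split; first by move=> A XA B XB /CG GA /CG GB; apply: (good_compare K).
  split.
    move=> Q XQ [n0 Qn0].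
    have [||||B [_ [[n [Qn nE]] HB]]] :=
      good_least (Zf := Zf) K (F := fam C) (P := fun B => exists n, Q n /\ B =
      sec0 C n).
    - exact: CG.
    - by pd.
    - by pd.
    - by exists (sec0 C n0); split=> //; exists n0.
    exists n; split=> // y Qy bl; apply: (HB (sec0 C y)) => //.
    - exact: fam_X (FC y).
    - by exists y.
    - by rewrite nE.
  split=> // A XA CA; have [_ [->|[A0 [g1 [_ [_ [g4 _]]]]]]] := CG A CA;
    first by left.
  by right.
split=> //.
case: (pselect (fam Z `<=` fam C)) => ZC; first by left; apply/seteqP.
right; have [||||A [ZA [nCA HA]]] :=
  good_least (Zf := Zf) K (F := fam Z) (P := fun B => ~ fam C B).
- exact: ZG.
- by pd.
- by pd.
- by apply: contrapT => H; apply: ZC => B ZB; apply: contrapT => nB; apply: H;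
  exists B.
have A0 : exists x, A x.
  by apply: contrapT => /nex_set0 A0; apply: nCA; rewrite A0.
have GA := ZG A ZA.
(* [C] is the least member of [fam Z] missing from the hull, both being good classes with the same
   family. *)
suff -> : C = A by [].
apply: (good_famI K GC GA C0 A0); apply/seteqP; split=> J.
  move=> CJ; case: (good_compare K (CG J CJ) GA) => [[]//|[JA|AJ]].
    by rewrite JA in CJ.
  by case: nCA; apply: Cdc AJ.
move=> AJ; apply: contrapT => nCJ; apply: (HA J) => //.
- by apply: fam_X AJ; case: GA.
- by apply: (Zdc A).
Qed.

Lemma good_def A B n u e : goods B -> fam B A -> (exists x, B x) ->
  exists m, forall x, sec B m x <->
    exists e', upd e (num 0) x e' /\ SatF B n u e' A A.
Proof.
move=> GB [z ->] B0; have [_ [HB1 _]] := good_code GB B0.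
by exists (pr (num 1) (pr (pr n (pr u e)) z)) => x; apply: HB1.
Qed.

(** The purpose of the third kind of instruction: [C] has the defined class as a section and lies in
    [fam Z], so a witness exists there, and the hull contains the least one. *)
Lemma code_def Z C A n u e : chain Z -> X C -> Code Z C -> fam Z C ->
  fam C A -> exists B, fam C B /\ exists m, forall x, sec B m x <->
    exists e', upd e (num 0) x e' /\ SatF C n u e' A A.
Proof.
move=> chZ XC cC ZC CA; have [CZ GC C0 satE _] := code_hull chZ XC cC.
have [XZ _ _ _] := chZ; have [HC _] := cC.
have famX : fam Z `<=` X by move=> D; apply: fam_X.
have [z zE] := CA; subst A.
have pC : witness (SatF Z) (pr (num 2) (pr n (pr u e))) C (sec0 C z).
  apply/witness2; have [m Hm] := good_def n u e GC CA C0; exists m => x;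
    rewrite Hm.
  by split=> -[e' [? ?]]; exists e'; split=> //; apply/satE.
have /witness2[m Hm] := hull_spec_wit famX HC ZC pC.
exists (sec0 C (pr (pr (num 2) (pr n (pr u e))) z)); split; first by eexists.
exists m => x; rewrite Hm.
by split=> -[e' [? ?]]; exists e'; split=> //; apply/satE.
Qed.

End Hulls.

(** * Actual formulas, and the translation of second-order formulas *)

Inductive tm : Type :=
| TMem of nat & nat
| TSec1 of nat & nat
| TSec2 of nat & nat
| TNand of tm & tm
| TAll of nat & tm
| TCAll of tm.

(** Each connective and quantifier uses up one index, so internal truth of [p] is correct at every
    [num k] with [tdep p <= k]. *)
Fixpoint tdep (p : tm) : nat :=
  match p with
  | TNand p q => (maxn (tdep p) (tdep q)).+1
  | TAll _ p | TCAll p => (tdep p).+1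
  | _ => 0
  end.

Fixpoint tkey (p : tm) : nat :=
  match p with
  | TMem i j | TSec1 i j | TSec2 i j => (maxn i j).+1
  | TNand p q => maxn (tkey p) (tkey q)
  | TAll i p => maxn i.+1 (tkey p)
  | TCAll p => tkey p
  end.

Definition updv (M : Type) (v : nat -> M) (i : nat) (x : M) (j : nat) : M :=
  if j == i then x else v j.

Section Terms.
Variables (M : Type) (E : M -> M -> Prop) (Zf : ZF E) (X : set (set M)).
Hypothesis K : KM E X.
Notation pr := (pr Zf).
Notation num := (num Zf).
Notation sec := (sec Zf).
Notation upd := (upd Zf).
Notation fam := (fam Zf).
Notation below := (below Zf).
Notation gclause := (gclause Zf X).
Notation SatF := (SatF Zf X).
Notation Code := (Code Zf X).
Notation goods := (goods Zf X).

Notation chain := (chain Zf X).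

Fixpoint tsat (F : set (set M)) (v : nat -> M) (A B : set M) (p : tm) : Prop :=
  match p with
  | TMem i j => E (v i) (v j)
  | TSec1 i j => A (pr (v i) (v j))
  | TSec2 i j => B (pr (v i) (v j))
  | TNand p q => ~ (tsat F v A B p /\ tsat F v A B q)
  | TAll i p => forall x, tsat F (updv v i x) A B p
  | TCAll p => forall C, F C -> tsat F v C A p
  end.

Fixpoint tcode (p : tm) : M :=
  match p with
  | TMem i j => pr (num 0) (pr (num i) (num j))
  | TSec1 i j => pr (num 1) (pr (num i) (num j))
  | TSec2 i j => pr (num 2) (pr (num i) (num j))
  | TNand p q => pr (num 3) (pr (tcode p) (tcode q))
  | TAll i p => pr (num 4) (pr (num i) (tcode p))
  | TCAll p => pr (num 5) (tcode p)
  end.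

(** Agreement is demanded on finitely many keys only, since an external assignment on all of [nat]
    need not be given by a set of [M]. *)
Definition Rep (N : nat) (v : nat -> M) (e : M) :=
  forall i, i < N -> forall x, E (pr (num i) x) e <-> x = v i.

Lemma Rep_upd N v e i x e' : Rep N v e -> upd e (num i) x e' ->
  Rep N (updv v i x) e'.
Proof.
move=> R Hu j jN y; rewrite /updv; case: eqP => [->|ne].
  exact: upd_same Hu.
by rewrite (upd_other _ Hu) ?R //; move/num_inj.
Qed.

Lemma Rep_ex N v : exists e, Rep N v e.
Proof.
elim: N => [|N [e R]]; first by exists (emp Zf).
have [e' Hu] := upd_ex Zf K e (num N) (v N); exists e' => i iN x.
case: (eqVneq i N) => [->|/eqP ne]; first exact: upd_same Hu.
rewrite (upd_other _ Hu); last by move/num_inj.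
apply: R; move: iN; rewrite ltnS leq_eqVlt => /orP[/eqP|] //.
Qed.

Ltac gcl_bad :=
  match goal with
  | |- (exists _, _) -> _ => move=> []; intro; gcl_bad
  | |- _ /\ _ -> _ => move=> [/pr_inj[/num_inj //]]
  end.

Section GClause.
Variables (I : Type) (J : I -> Prop) (F : set (set M)).
Variable s : I -> M -> M -> set M -> set M -> Prop.

Lemma gclause0 i j e A B : gclause J F s (pr (num 0) (pr i j)) e A B <->
  exists x y, E (pr i x) e /\ E (pr j y) e /\ E x y.
Proof.
split=> [|[x [y H]]]; last by left; exists i, j, x, y.
case; first by move=> [i' [j' [x [y [/pr_inj[_ /pr_inj[-> ->]] H]]]]];
  exists x, y.
by do 4!(case; first by gcl_bad); gcl_bad.
Qed.

Lemma gclause1 i j e A B : gclause J F s (pr (num 1) (pr i j)) e A B <->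
  exists x y, E (pr i x) e /\ E (pr j y) e /\ A (pr x y).
Proof.
split=> [|[x [y H]]]; last by right; left; exists i, j, x, y.
case; first by gcl_bad.
case; first by move=> [i' [j' [x [y [/pr_inj[_ /pr_inj[-> ->]] H]]]]];
  exists x, y.
by do 3!(case; first by gcl_bad); gcl_bad.
Qed.

Lemma gclause2 i j e A B : gclause J F s (pr (num 2) (pr i j)) e A B <->
  exists x y, E (pr i x) e /\ E (pr j y) e /\ B (pr x y).
Proof.
split=> [|[x [y H]]]; last by right; right; left; exists i, j, x, y.
do 2!(case; first by gcl_bad).
case; first by move=> [i' [j' [x [y [/pr_inj[_ /pr_inj[-> ->]] H]]]]];
  exists x, y.
by do 2!(case; first by gcl_bad); gcl_bad.
Qed.

Lemma gclause3 u u' e A B : gclause J F s (pr (num 3) (pr u u')) e A B <->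
  forall m, J m -> ~ (s m u e A B /\ s m u' e A B).
Proof.
split=> [|H]; last by do 3!right; left; exists u, u'.
do 3!(case; first by gcl_bad).
case; first by move=> [i' [j' [/pr_inj[_ /pr_inj[-> ->]] H]]].
by (case; first by gcl_bad); gcl_bad.
Qed.

Lemma gclause4 i u e A B : gclause J F s (pr (num 4) (pr i u)) e A B <->
  forall m, J m -> forall y e', upd e i y e' -> s m u e' A B.
Proof.
split=> [|H]; last by do 4!right; left; exists i, u.
do 4!(case; first by gcl_bad).
case; first by move=> [i' [j' [/pr_inj[_ /pr_inj[-> ->]] H]]].
by gcl_bad.
Qed.

Lemma gclause5 u e A B : gclause J F s (pr (num 5) u) e A B <->
  forall m, J m -> forall C, X C -> F C -> s m u e C A.
Proof.
split=> [|H]; last by do 5!right; exists u.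
do 5!(case; first by gcl_bad).
by move=> [i' [/pr_inj[_ ->] H]].
Qed.

End GClause.

Lemma tsat_link (F : set (set M)) (s : nat -> M -> M -> set M -> set M ->
  Prop) :
  F `<=` X ->
  (forall k t e A B, F A -> F B ->
     (s k t e A B <-> gclause (fun m => k = m.+1) F s t e A B)) ->
  forall p k v e A B N, tdep p <= k -> tkey p <= N -> Rep N v e ->
  F A -> F B -> (s k (tcode p) e A B <-> tsat F v A B p).
Proof.
move=> FX sE; elim=> [i j|i j|i j|p IHp q IHq|i p IHp|p IHp] k v e A B N /=.
- move=> _; rewrite gtn_max => /andP[iN jN] R FA FB; rewrite sE // gclause0.
  split=> [[x [y [/R -> // [/R -> //]]]]//|H].
  by exists (v i), (v j); rewrite !R.
- move=> _; rewrite gtn_max => /andP[iN jN] R FA FB; rewrite sE // gclause1.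
  split=> [[x [y [/R -> // [/R -> //]]]]//|H].
  by exists (v i), (v j); rewrite !R.
- move=> _; rewrite gtn_max => /andP[iN jN] R FA FB; rewrite sE // gclause2.
  split=> [[x [y [/R -> // [/R -> //]]]]//|H].
  by exists (v i), (v j); rewrite !R.
- case: k => [//|k]; rewrite ltnS geq_max => /andP[pk qk].
  rewrite geq_max => /andP[pN qN] R FA FB; rewrite sE // gclause3.
  rewrite -(IHp k v e A B N) // -(IHq k v e A B N) //.
  by split=> [|H m [<-]//]; apply.
- case: k => [//|k]; rewrite ltnS => pk.
  rewrite geq_max => /andP[iN pN] R FA FB; rewrite sE // gclause4.
  split=> [H x|H m [<-] y e' Hu].
    have [e' Hu] := upd_ex Zf K e (num i) x.
    by apply/(IHp k _ e' A B N) => //; [apply: Rep_upd Hu|apply: (H k _ x)].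
  by apply/(IHp k (updv v i y) e' A B N) => //; apply: Rep_upd Hu.
- case: k => [//|k]; rewrite ltnS => pk pN R FA FB; rewrite sE // gclause5.
  split=> [H C FC|H m [<-] C _ FC].
    by apply/(IHp k v e C A N) => //; apply: H => //; apply: FX.
  by apply/(IHp k v e C A N) => //; apply: H.
Qed.

Lemma SatF_num Z k t e A B : X Z -> fam Z A -> fam Z B ->
  (SatF Z (num k) t e A B <->
   gclause (fun m => k = m.+1) (fam Z) (fun m => SatF Z (num m)) t e A B).
Proof.
move=> XZ ZA ZB; rewrite SatFE //; apply: gclause_elem => //.
- by move=> C; apply: fam_X.
- by move=> m /mem_num[j -> ->]; exists j.
- by move=> j kE; exists (num j); split=> //; apply/mem_num; exists j.
Qed.

Lemma SatF_link Z p k v e A B N : X Z -> tdep p <= k -> tkey p <= N ->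
  Rep N v e -> fam Z A -> fam Z B ->
  (SatF Z (num k) (tcode p) e A B <-> tsat (fam Z) v A B p).
Proof.
move=> XZ; apply: (tsat_link (s := fun m => SatF Z (num m))).
  by move=> C; apply: fam_X.
by move=> *; apply: SatF_num.
Qed.

(** Comprehension for [sections F] in a form fit for terms: class parameters enter as sections of
    the single class [A], named by [v], and key 0 is the comprehended variable. *)
Definition tm_closed (F : set (set M)) := forall p v A, F A ->
  exists B, F B /\ exists m, forall x, sec B m x <-> tsat F (updv v 0 x) A A p.

Lemma good_tdef A B p v : goods B -> fam B A -> (exists x, B x) ->
  exists m, forall x, sec B m x <-> tsat (fam B) (updv v 0 x) A A p.
Proof.
move=> GB BA B0; have [XB _] := GB.
have [e R] := Rep_ex (tkey p) v.
have [m Hm] := good_def (num (tdep p)) (tcode p) e GB BA B0.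
exists m => x; rewrite Hm; split=> [[e' [Hu Hs]]|H].
  by apply/(SatF_link XB (leqnn _) (leqnn _) (Rep_upd R Hu)).
have [e' Hu] := upd_ex Zf K e (num 0) x; exists e'; split=> //.
by apply/(SatF_link XB (leqnn _) (leqnn _) (Rep_upd R Hu)).
Qed.

Lemma code_tm_closed Z C : chain Z -> X C -> Code Z C -> fam Z C ->
  tm_closed (fam C).
Proof.
move=> chZ XC cC ZC p v A CA.
have [e R] := Rep_ex (tkey p) v.
have [B [CB [m Hm]]] := code_def K (num (tdep p)) (tcode p) e chZ XC cC ZC CA.
exists B; split=> //; exists m => x; rewrite Hm; split=> [[e' [Hu Hs]]|H].
  by apply/(SatF_link XC (leqnn _) (leqnn _) (Rep_upd R Hu)).
have [e' Hu] := upd_ex Zf K e (num 0) x; exists e'; split=> //.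
by apply/(SatF_link XC (leqnn _) (leqnn _) (Rep_upd R Hu)).
Qed.

Definition sections (F : set (set M)) : set (set M) :=
  fun D => exists A x, F A /\ D = sec A x.

(** A section of [A] is definable over [fam B] from [A], and definable classes over [fam B] are
    sections of [B]. *)
Lemma below_sec A B x : goods B -> below A B -> exists m, sec A x = sec B m.
Proof.
move=> GB [B0 BA].
have [m Hm] := good_tdef (TSec1 1 0) (fun=> x) GB BA B0.
by exists m; apply/seteqP; split=> y /Hm.
Qed.

Definition init (F : set (set M)) :=
  [/\ F `<=` goods, F set0 & forall A B, F A -> below B A -> F B].

Section Translation.
Variable F : set (set M).
Hypothesis iF : init F.

Definition TNot p := TNand p p.
Definition TImp p q := TNand p (TNot q).
Definition TAnd p q := TNot (TNand p q).
Definition TIff p q := TAnd (TImp p q) (TImp q p).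

Lemma tsat_not v A B p : tsat F v A B (TNot p) <-> ~ tsat F v A B p.
Proof. by split=> [/= H H'|H [? _]]; first exact: H. Qed.

Lemma tsat_imp v A B p q :
  tsat F v A B (TImp p q) <-> (tsat F v A B p -> tsat F v A B q).
Proof.
split=> [/= H Hp|H [Hp /tsat_not Hq]]; last exact: Hq (H Hp).
by apply: contrapT => Hq; apply: H; split=> // -[].
Qed.

Lemma tsat_and v A B p q :
  tsat F v A B (TAnd p q) <-> (tsat F v A B p /\ tsat F v A B q).
Proof. by rewrite tsat_not /=; split=> [/contrapT|? ?]. Qed.

Lemma tsat_iff v A B p q :
  tsat F v A B (TIff p q) <-> (tsat F v A B p <-> tsat F v A B q).
Proof. by rewrite tsat_and !tsat_imp; split=> -[]. Qed.

Lemma tsat_allE v A B i p :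
  tsat F v A B (TAll i p) = forall x, tsat F (updv v i x) A B p.
Proof. by []. Qed.

Lemma tsat_callE v A B p :
  tsat F v A B (TCAll p) = forall C, F C -> tsat F v C A p.
Proof. by []. Qed.

Fixpoint TAlls (a n : nat) (p : tm) : tm :=
  if n is m.+1 then TAll (a + m) (TAlls a m p) else p.

Lemma tsat_alls a n p : forall v A B, tsat F v A B (TAlls a n p) <->
  forall w, (forall i, ~ (a <= i < a + n) -> w i = v i) -> tsat F w A B p.
Proof.
elim: n => [|n IH] v A B /=.
  split=> [H w wv|H]; last exact: H.
  suff -> : w = v by [].
  by apply: funext => i; apply: wv;
    rewrite addn0 => /andP[ai /(leq_ltn_trans ai)]; rewrite ltnn.
split=> [H w wv|H x].
  move/IH: (H (w (a + n))); apply=> i Hi; rewrite /updv; case: eqP => [->//|ne].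
  apply: wv => /andP[ai]; rewrite addnS ltnS leq_eqVlt => /orP[/eqP//|ia].
  by apply: Hi; rewrite ai.
apply/IH => w wv; apply: H => i Hi; rewrite wv; last first.
  by move=> /andP[ai ia]; apply: Hi; rewrite ai addnS ltnS ltnW.
rewrite /updv; case: eqP => // iE; case: Hi.
by rewrite iE leq_addr addnS ltnS leqnn.
Qed.

(** The bound variable takes key [N.*2], which is clear of the keys below [N] and of the block
    starting at [N]. The base case is a tautology. *)
Fixpoint TEqs (N n : nat) : tm :=
  if n is m.+1 then
    TAnd (TAll N.*2 (TIff (TSec1 (N + m) N.*2) (TSec2 m N.*2))) (TEqs N m)
  else TNand (TMem 0 0) (TNot (TMem 0 0)).

Lemma tsat_eqs N n v A B : n <= N ->
  (tsat F v A B (TEqs N n) <->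
   forall j, j < n -> sec A (v (N + j)) = sec B (v j)).
Proof.
elim: n => [|n IH] nN.
  by split=> // _ /= [H H']; apply: H'.
rewrite /TEqs -/TEqs tsat_and IH; last exact: ltnW.
have -> : tsat F v A B (TAll N.*2 (TIff (TSec1 (N + n) N.*2) (TSec2 n N.*2)))
   <-> sec A (v (N + n)) = sec B (v n).
  have e1 : (N + n == N.*2) = false.
    by apply/negbTE; rewrite -addnn eqn_add2l neq_ltn nN.
  have e2 : (n == N.*2) = false.
    by apply/negbTE; rewrite neq_ltn -addnn (leq_trans nN) // leq_addr.
  rewrite tsat_allE; split=> [H|H x].
    apply/seteqP; split=> x; move/tsat_iff: (H x) => /=;
    by rewrite /updv eqxx e1 e2 /sec => ->.
  apply/tsat_iff; rewrite /= /updv eqxx e1 e2.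
  by change (sec A (v (N + n)) x <-> sec B (v n) x); rewrite H.
split=> [[H1 H2] j|H]; last by split=> [|j jn]; apply: H => //; rewrite ltnW.
by rewrite ltnS leq_eqVlt => /orP[/eqP ->|] //; apply: H2.
Qed.

Lemma sections_join A A' : F A -> F A' -> exists C, [/\ F C,
  (forall x, exists m, sec A x = sec C m) &
  (forall x, exists m, sec A' x = sec C m)].
Proof.
have [FG _ _] := iF; move=> FA FA'.
case: (good_compare K (FG _ FA) (FG _ FA')) => [bl|[<-|bl]].
- exists A'; split=> // x; last by exists x.
  by apply: below_sec bl; apply: FG.
- by exists A; split=> // x; exists x.
- exists A; split=> // x; first by exists x.
  by apply: below_sec bl; apply: FG.
Qed.

Lemma updv_lt (v : nat -> M) N x i : i < N -> updv v N x i = v i.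
Proof. by move=> iN; rewrite /updv ltn_eqF. Qed.

Lemma updv_eq (v : nat -> M) N x : updv v N x N = x.
Proof. by rewrite /updv eqxx. Qed.

(* A class quantifier over [sections F] loads a code [C] above the present
   base [A] and renames the sections of [A] in use to sections of [C]. *)
Lemma translate phi : forall f g N, (forall k, f k < N) ->
  (forall k, g k < N) ->
  exists p, forall w A B, F A -> F B ->
   (tsat F w A B p <->
    sat2 E (sections F) (w \o f) (fun k => sec A (w (g k))) phi).
Proof.
elim: phi => [i j|i j|i k|k l||p IHp q IHq|p IHp|p IHp] f g N fN gN.
- by exists (TMem (f i) (f j)).
- exists (TAll N (TIff (TMem N (f i)) (TMem N (f j)))) => w A B FA FB.
  rewrite tsat_allE; split=> [H|H x].
    apply: (ZF_extensionality Zf) => x; move/tsat_iff: (H x) => /=.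
    by rewrite updv_eq !updv_lt.
  by apply/tsat_iff; move: H; rewrite /= updv_eq !updv_lt // => ->.
- by exists (TSec1 (g k) (f i)).
- exists (TAll N (TIff (TSec1 (g k) N) (TSec1 (g l) N))) => w A B FA FB.
  rewrite tsat_allE; split=> [H|H x].
    apply/seteqP; split=> x; move/tsat_iff: (H x) => /=;
    by rewrite updv_eq !updv_lt // /sec => ->.
  apply/tsat_iff; move: H; rewrite /= updv_eq !updv_lt // => H.
  by change (sec A (w (g k)) x <-> sec A (w (g l)) x); rewrite H.
- exists (TNot (TNand (TMem 0 0) (TNot (TMem 0 0)))) => w A B FA FB.
  by rewrite tsat_not; split=> // H; apply: H => -[/= ?]; apply.
- have [p' Hp] := IHp f g N fN gN; have [q' Hq] := IHq f g N fN gN.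
  by exists (TImp p' q') => w A B FA FB; rewrite tsat_imp Hp // Hq.
- have [||p' Hp] := IHp (scons N f) g N.+1.
  + by case=> //= k; rewrite ltnW // ltnS.
  + by move=> k; rewrite ltnW // ltnS.
  exists (TAll N p') => w A B FA FB /=.
  have envE x : updv w N x \o scons N f = scons x (w \o f).
    by apply: funext => -[|k] /=; rewrite ?updv_eq ?updv_lt.
  have envE' x : (fun k => sec A (updv w N x (g k))) = (fun k => sec A (w (g
    k))).
    by apply: funext => k; rewrite updv_lt.
  by split=> H x; move: (H x); rewrite Hp // envE envE'.
(* Keys below [N] keep their values, the block from [N] on holds names in the new base [C] for the
   old sections of [A], and [N.*2] holds the name in [C] of the quantified class. *)
- have [||p' Hp] := IHp f (scons N.*2 (fun k => N + g k)) N.*2.+1.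
  + by move=> k; rewrite ltnS ltnW // (leq_trans (fN k)) // -addnn leq_addr.
  + by case=> //= k; rewrite ltnS ltnW // -addnn ltn_add2l.
  exists (TCAll (TAlls N N (TImp (TEqs N N) (TAll N.*2 p')))) => w A B FA FB.
  rewrite tsat_callE; split=> [H D [A'' [m [FA'' ->]]]|/= H C FC].
    (* The base [C] must have both the sections of [A] in use and the instance from [A'']; its new
       names are then chosen by [nm]. *)
    have [C [FC HC1 HC2]] := sections_join FA FA''.
    pose nm x := sval (cid (HC1 x)).
    have nmE x : sec A x = sec C (nm x) by rewrite /nm; case: cid.
    have [mD mE] := HC2 m.
    pose w' i := if N <= i < N + N then nm (w (i - N)) else w i.
    have wlt i : i < N -> w' i = w i by rewrite /w' ltnNge => /negbTE ->.
    have whi j : j < N -> w' (N + j) = nm (w j).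
      by move=> jN; rewrite /w' leq_addr ltn_add2l jN addKn.
    have /tsat_alls /(_ w') := H C FC.
    have agr i : ~ N <= i < N + N ->
      w' i = w i by rewrite /w' => /negP/negbTE ->.
    move=> /(_ agr) /tsat_imp.
    rewrite tsat_eqs // => /(_ _) H'.
    have /H' : forall j, j < N -> sec C (w' (N + j)) = sec A (w' j).
      by move=> j jN; rewrite whi // wlt // -nmE.
    rewrite tsat_allE => /(_ mD); rewrite Hp //.
    have -> : updv w' N.*2 mD \o f = w \o f.
      apply: funext => k /=; rewrite updv_lt ?wlt //.
      by rewrite (leq_trans (fN k)) // -addnn leq_addr.
    suff -> : (fun k => sec C (updv w' N.*2 mD (scons N.*2 (fun k => N + g k)
      k)))
      = scons (sec A'' m) (fun k => sec A (w (g k))) by [].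
    apply: funext => -[|k] /=; first by rewrite updv_eq.
    by rewrite updv_lt ?whi -?nmE // -addnn ltn_add2l.
  apply/tsat_alls => w' agr; apply/tsat_imp;
    rewrite tsat_eqs // tsat_allE => eqs x.
  have wlt i : i < N -> w' i = w i by move=> iN; apply: agr; rewrite leqNgt iN.
  rewrite Hp //.
  have -> : updv w' N.*2 x \o f = w \o f.
    apply: funext => k /=; rewrite updv_lt ?wlt //.
    by rewrite (leq_trans (fN k)) // -addnn leq_addr.
  have -> : (fun k => sec C (updv w' N.*2 x (scons N.*2 (fun k => N + g k) k)))
      = scons (sec C x) (fun k => sec A (w (g k))).
    apply: funext => -[|k] /=; first by rewrite updv_eq.
    by rewrite updv_lt ?eqs ?wlt // -addnn ltn_add2l.
  by apply: H; exists C, x.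
Qed.

End Translation.

End Terms.

(** * Realizations made of the sections of good classes *)

Fixpoint var_bound (phi : formula2) : nat :=
  match phi with
  | Mem2 i j | Eq2 i j | In2 i j | ClassEq2 i j => (maxn i j).+1
  | Bot2 => 0
  | Imp2 p q => maxn (var_bound p) (var_bound q)
  | All2 p | ClassAll2 p => var_bound p
  end.

Lemma sat2_var_bound (M : Type) (E : M -> M -> Prop) (X : set (set M)) phi :
  forall n v v' V V', var_bound phi <= n ->
  (forall i, i < n -> v i = v' i) -> (forall i, i < n -> V i = V' i) ->
  (sat2 E X v V phi <-> sat2 E X v' V' phi).
Proof.
elim: phi => [i j|i j|i k|k l||p IHp q IHq|p IHp|p IHp] n v v' V V' /=.
- by rewrite gtn_max => /andP[? ?] Hv _; rewrite !Hv.
- by rewrite gtn_max => /andP[? ?] Hv _; rewrite !Hv.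
- by rewrite gtn_max => /andP[? ?] Hv HV; rewrite Hv // HV.
- by rewrite gtn_max => /andP[? ?] _ HV; rewrite !HV.
- by [].
- rewrite geq_max => /andP[? ?] Hv HV.
  by rewrite (IHp n v v' V V') // (IHq n v v' V V').
- move=> pn Hv HV; have aux x : forall i, i < n -> scons x v i = scons x v' i.
    by case=> //= i iN; apply: Hv; apply: ltnW.
  have Hx x := IHp n _ _ V V' pn (aux x) HV.
  by split=> H x; apply/Hx.
- move=> pn Hv HV; have aux x : forall i, i < n -> scons x V i = scons x V' i.
    by case=> //= i iN; apply: HV; apply: ltnW.
  have Hx x := IHp n v v' _ _ pn Hv (aux x).
  by split=> H x Xx; apply/Hx; apply: H.
Qed.

Section Core.
Variables (M : Type) (E : M -> M -> Prop) (Zf : ZF E) (X : set (set M)).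
Hypothesis K : KM E X.
Notation definable := (definable E X).
Notation definable_class := (definable_class E X).
Notation pr := (pr Zf).
Notation num := (num Zf).
Notation sec := (sec Zf).
Notation sec0 := (sec0 Zf).
Notation fam := (fam Zf).
Notation below := (below Zf).
Notation gclause := (gclause Zf X).
Notation SatF := (SatF Zf X).
Notation witness := (witness Zf).
Notation least_in := (least_in Zf X).
Notation hull_value := (hull_value Zf X).
Notation hull_spec := (hull_spec Zf X).
Notation Code := (Code Zf X).
Notation good := (good Zf X).
Notation goods := (goods Zf X).

Notation chain := (chain Zf X).
Notation tsat := (tsat Zf).
Notation tm_closed := (tm_closed Zf).
Notation sections := (sections Zf).
Notation init := (init Zf X).

Lemma sections_sub F : init F -> sections F `<=` X.
Proof.
move=> [FG _ _] D [A [x [FA ->]]]; apply: sec_X => //; exact: (proj1 (FG A FA)).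
Qed.

(** A formula has finitely many class parameters, so one class of [F] has all those in use as
    sections. *)
Lemma sections_names F n V : init F -> (forall k, sections F (V k)) ->
  exists A, F A /\ forall i, i < n -> exists m, V i = sec A m.
Proof.
move=> iF HV; elim: n => [|n [A [FA HA]]].
  by exists set0; split=> //; case: iF.
have [A' [x [FA' xE]]] := HV n.
have [C [FC H1 H2]] := sections_join K iF FA FA'.
exists C; split=> // i; rewrite ltnS leq_eqVlt => /orP[/eqP ->|iN].
  by have [m mE] := H2 x; exists m; rewrite xE.
by have [m mE] := HA i iN; have [m' mE'] := H1 m; exists m'; rewrite mE.
Qed.

Lemma KM_sections F : init F -> tm_closed F -> KM E (sections F).
Proof.
move=> iF clF; have [FG F0 Fdc] := iF.
split=> //.
- by exists (sec set0 (emp Zf)), set0, (emp Zf).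
- by move=> A B _ _ AB; apply/predeqP.
- by move=> D /(sections_sub iF); apply: (KM_class_replacement K).
move=> phi v V HV; set n := (var_bound phi).+1.
have [A [FA HA]] := sections_names n iF HV.
pose nm i := if pselect (i < n) is left H then sval (cid (HA i H)) else emp Zf.
have nmE i : i < n -> V i = sec A (nm i).
  by move=> iN; rewrite /nm; case: pselect => // H; case: cid.
(* Key 0 is for the comprehended element, keys 1 to [n.-1] are for set parameters, and keys from [n]
   on for names of class parameters. Indices from [n] on do not occur in [phi] and default to 0,
   which is below [n] because of the successor in [n]. *)
pose f i := if i < n then i else 0.
pose g i := n + f i.
have fn i : f i < n by rewrite /f; case: ifP.
have [||p Hp] := translate K iF phi (f := f) (g := g) (N := n + n).
- by move=> k; rewrite (leq_trans (fn k)) // leq_addr.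
- by move=> k; rewrite ltn_add2l.
pose w i := if i < n then v i.-1 else nm (i - n).
have [B [FB [m Hm]]] := clF p w A FA.
exists B, m; split=> //; apply/predeqP => x /=; rewrite Hm Hp //.
apply: (sat2_var_bound E (sections F) (n := n)); first exact: leqnSn.
- case=> [|i] iN /=; rewrite /f iN /= /updv //=.
  by rewrite /w iN.
- by move=> i iN; rewrite /g /f iN /updv /= /w ltnNge leq_addr /= addKn nmE.
Qed.

Lemma definable_good F : definable_class F ->
  definable (fun v V => good (F v V)).
Proof.
move=> HF; rewrite /good /Code /hull_spec /hull_value /least_in /witness
  /wf_for /nonempty.
by pd.
Qed.

Lemma definable_goods F : definable_class F ->
  definable (fun v V => goods (F v V)).
Proof.
move=> HF; apply: definable_ext (definable_good HF) => v V XV;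
  split=> [gC|[]//].
by split=> //; apply: (definable_class_X K).
Qed.

Lemma goods_X : goods `<=` X.
Proof. by move=> A []. Qed.

Lemma init_goods : init goods.
Proof.
by split=> //; [apply: good_set0|move=> A B GA; apply: good_below].
Qed.

Lemma init_fam C : goods C -> (exists x, C x) -> init (fam C).
Proof.
move=> GC C0; split.
- by move=> A; apply: good_fam.
- exact: (good_fam0 GC C0).
- by move=> A B CA bl; have [] := good_trans K GC (conj C0 CA) bl.
Qed.

Lemma KM_sections_coded Z : X Z -> fam Z = goods ->
  exists C, [/\ goods C, exists x, C x & KM E (sections (fam C))].
Proof.
move=> XZ ZG.
have chZ : chain Z.
  by split=> //; rewrite ZG //; [apply: good_set0|move=> A B GA;
    apply: good_below].
have [C [XC cC]] := code_ex K chZ.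
have [_ GC C0 _ _] := code_hull K chZ XC cC.
exists C; split=> //; apply: KM_sections; first exact: init_fam.
by apply: (code_tm_closed K chZ) => //; rewrite ZG.
Qed.

Section Uncoded.
Hypothesis unc : ~ exists Z, X Z /\ fam Z = goods.

Lemma goods_least P : definable (fun v V => P (V 0)) ->
  (exists B, goods B /\ P B) ->
  exists B, least_in goods P B.
Proof. by move=> HP; apply: good_least => //; apply: definable_goods; pd. Qed.

Lemma goods_least_uniq P A B : least_in goods P A -> least_in goods P B ->
  A = B.
Proof. by apply: least_in_uniq goods_X (good_compare K). Qed.

(** Since [Z] does not code all good classes, there is a least good class outside [fam Z], and what
    is below it is exactly [fam Z]. *)
Lemma chain_next Z : chain Z ->
  exists B, [/\ goods B, exists x, B x & fam B = fam Z].
Proof.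
move=> [XZ ZG Z0 Zdc].
have [||B [GB [nZB HB]]] := goods_least (P := fun B => ~ fam Z B).
- by pd.
- apply: contrapT => H; apply: unc; exists Z; split=> //.
  apply/seteqP; split=> [|A GA]; first exact: ZG.
  by apply: contrapT => nA; apply: H; exists A.
have B0 : exists x, B x.
  by apply: contrapT => /nex_set0 B0; apply: nZB; rewrite B0.
exists B; split=> //; apply/seteqP; split=> J.
  move=> BJ; have blJ : below J B by [].
  apply: contrapT => nJ; apply: (HB J) => //.
    by apply: fam_X BJ; case: GB.
  exact: good_below blJ.
move=> ZJ; case: (good_compare K (ZG J ZJ) GB) => [[]//|[JB|BJ]].
  by rewrite JB in ZJ.
by case: nZB; apply: Zdc BJ.
Qed.

(* Since the least witness is unique, the witnesses can be put side by side in
   one class; this is where canonicity of the codes pays off. *)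
Lemma collect P : definable (fun v V => P (v 0) (V 0)) ->
  (forall x, exists A, goods A /\ P x A) ->
  exists B, goods B /\ forall x, exists A, below A B /\ P x A.
Proof.
move=> HP exP.
have HP' x : definable (fun v V => P x (V 0)).
  exact: (definable_mterm (Q := fun x v V => P x (V 0)) (definable_term_const E
    X x) HP).
have lx x : exists A, least_in goods (P x) A by apply: goods_least => //;
  apply: exP.
have HG : definable (fun v V => goods (V 0)) by apply: definable_goods; pd.
pose Q A x := least_in goods (P x) A.
have HQ : definable (fun v V => Q (V 0) (v 0)).
  rewrite /Q /least_in; apply: definable_and; first by pd.
  apply: definable_and; first exact: HP.
  apply: definable_call; apply: definable_imp; first by pd.
  by apply: definable_imp; [exact: (definable_ren id id HP)|pd].
(* Names with tag 0 list the classes below the least witness for [x], and names with tag 1 the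
   witness itself. *)
pose Z := [set p | exists x d y, p = pr (pr (num 0) (pr x d)) y /\
  exists A, X A /\ (Q A x /\ ((exists n, d = pr (num 0) n /\ sec0 A n y) \/
                          (exists n, d = pr (num 1) n /\ A y)))].
have XZ : X Z by apply: (class_comprehension K); pd.
have ZE0 x A n : Q A x -> sec0 Z (pr x (pr (num 0) n)) = sec0 A n.
  move=> QA; apply/seteqP; split=> y.
    move=> [x' [d [y' [/pr_inj[/pr_inj[_ /pr_inj[xE dE]] yE] [A' [_ [QA'
      H]]]]]]].
    subst x' d y'; rewrite (goods_least_uniq QA QA').
    by case: H => [[n' [/pr_inj[_ ->]]]|[n' [/pr_inj[/num_inj]]]].
  move=> Ay; exists x, (pr (num 0) n), y; split=> //; exists A.
  by split; [case: QA => -[]|split=> //; left; exists n].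
have ZE1 x A n : Q A x -> sec0 Z (pr x (pr (num 1) n)) = A.
  move=> QA; apply/seteqP; split=> y.
    move=> [x' [d [y' [/pr_inj[/pr_inj[_ /pr_inj[xE dE]] yE] [A' [_ [QA'
      H]]]]]]].
    subst x' d y'; rewrite (goods_least_uniq QA QA').
    by case: H => [[n' [/pr_inj[/num_inj]]]|[n' [/pr_inj[_ _]]]].
  move=> Ay; exists x, (pr (num 1) n), y; split=> //; exists A.
  by split; [case: QA => -[]|split=> //; right; exists n].
have ZG : fam Z `<=` goods.
  move=> B [k ->].
  case: (pselect (exists y, sec0 Z k y)) => [[y Zy]|/nex_set0 ->];
    last exact: good_set0.
  case: Zy => x [d [y' [/pr_inj[/pr_inj[_ ->] _] [A [_ [QA H]]]]]].
  have GA : goods A by case: QA.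
  case: H => [[n [-> Ay]]|[n [-> Ay]]]; last by rewrite (ZE1 _ A).
  rewrite (ZE0 _ A) //.
  case: (pselect (exists y, A y)) => [A0|/nex_set0 A0]; last by move: Ay;
    rewrite A0.
  by apply: good_fam A0 _ => //; exists n.
(* Without a bound, every good class is at or below some least witness, so [Z] would code all good
   classes. *)
apply: contrapT => H; apply: unc; exists Z; split=> //.
apply/seteqP; split=> [|B GB]; first exact: ZG.
have [x nx] : exists x, ~ exists A, below A B /\ P x A.
  apply: contrapT => H'; apply: H; exists B; split=> // x.
  by apply: contrapT => nx; apply: H'; exists x.
have [A QA] := lx x; have [GA [PA _]] := QA.
case: (good_compare K GA GB) => [AB|[AB|[A0 [n ->]]]].
- by case: nx; exists A.
- by rewrite -AB; exists (pr x (pr (num 1) x)); rewrite (ZE1 _ A).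
- by exists (pr x (pr (num 0) n)); rewrite (ZE0 _ A).
Qed.

(** No class codes [goods] here, so its truth is defined outside, one predicate for each level. The
    index conditions speak of elements of [M] to keep each level definable over [(M, X)]. *)
Fixpoint goods_sat (k : nat) (t e : M) (A B : set M) : Prop :=
  match k with
  | 0 => gclause (fun m => E m (emp Zf)) goods (fun _ _ _ _ _ => True) t e A B
  | j.+1 => gclause (fun m => m = emp Zf) goods (fun _ => goods_sat j) t e A B
  end.

Lemma goods_satE k t e A B : goods A -> goods B ->
  (goods_sat k t e A B <-> gclause (fun m => k = m.+1) goods goods_sat t e A B).
Proof.
move=> GA GB; case: k => [|k] /=; apply: gclause_elem => //.
- exact: goods_X.
- by move=> m /empP.
- exact: goods_X.
- by move=> m _; exists k.
- by move=> m [<-]; exists (emp Zf).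
Qed.

Lemma definable_goods_sat k : definable (fun v V => goods_sat k (v 0) (v 1) (V
  0) (V 1)).
Proof.
have HG : definable (fun v V => goods (V 0)) by apply: definable_goods; pd.
elim: k => [|k IH]; rewrite /goods_sat -/goods_sat /gclause; first by pd.
by pd.
Qed.

(** The levels below [k] in one predicate of an internal index, as [witness] expects. At other
    indices it is true, so that no witness of the first kind is asked for. *)
Fixpoint goods_sat_lt (k : nat) (n u e : M) (A B : set M) : Prop :=
  if k is j.+1 then (n = num j ->
    goods_sat j u e A B) /\ goods_sat_lt j n u e A B else True.

Lemma definable_goods_sat_lt k : definable (fun v V => goods_sat_lt k (v 0) (v
  1) (v 2) (V 0) (V 1)).
Proof.
elim: k => [|k IH] /=; first by pd.
have Hk := definable_goods_sat k.
apply: definable_and; last exact: IH.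
by pd.
Qed.

Lemma goods_sat_lt_ge k j u e A B : k <= j -> goods_sat_lt k (num j) u e A B.
Proof.
elim: k => [//|k IH] kj /=; split; last by apply: IH; apply: ltnW.
by move/num_inj => jE; rewrite jE ltnn in kj.
Qed.

Lemma goods_sat_lt_num k j u e A B : j < k ->
  (goods_sat_lt k (num j) u e A B <-> goods_sat j u e A B).
Proof.
elim: k => [//|k IH]; rewrite ltnS leq_eqVlt => /orP[/eqP ->|jk] /=.
  by split=> [[H _]|H]; [apply: H|split=> //; apply: goods_sat_lt_ge].
rewrite IH //; split=> [[]//|H]; split=> // /num_inj jE.
by rewrite jE ltnn in jk.
Qed.

(** The hull of [A0] for the levels below [k] is coded by a class, so by [chain_next] it is the
    family of a good [B]. The Tarski-Vaught step is then made once for each level. *)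
Lemma reflection k A0 : goods A0 -> exists B, [/\ goods B, below A0 B &
  forall j t e A A', j <= k -> fam B A -> fam B A' ->
    (SatF B (num j) t e A A' <-> goods_sat j t e A A')].
Proof.
move=> GA0; have XA0 := goods_X GA0.
have [||||S [XS HS]] := hull_ex (Zf := Zf) (F := goods) (s := goods_sat_lt k) K
  goods_X _ _ GA0.
- by apply: definable_goods; pd.
- exact: definable_goods_sat_lt.
- exact: good_compare.
- by move=> P HP; apply: goods_least.
pose C := [set p | exists x y, p = pr (pr (num 0) x) y /\ S (pr x y)].
have XC : X C by apply: (class_comprehension K); pd.
have CE x : sec0 C x = sec S x.
  apply/seteqP; split=> y;
    first by move=> [x' [y' [/pr_inj[/pr_inj[_ ->] ->]]]].
  by move=> Sy; exists x, y.
have HC : hull_spec goods (goods_sat_lt k) A0 C.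
  by move=> x; rewrite CE; apply: hull_value_loc (HS x) => z _.
have Gdc A B : goods A -> below B A -> goods B by apply: good_below.
have CG : fam C `<=` goods by move=> A [x ->]; apply: hull_spec_fam HC.
have Cdc A B : fam C A -> below B A -> fam C B.
  by apply: (hull_spec_closed goods_X Gdc GA0 HC).
have CA0 : fam C A0 by exists (emp Zf); rewrite (hull_spec_fam0 HC).
have C0 : fam C set0.
  case: (pselect (exists x, A0 x)) => [A00|/nex_set0 <- //].
  by apply: (Cdc A0) => //; split=> //; apply: (good_fam0 GA0).
have [B [GB B0 BC]] := chain_next (And4 XC CG C0 Cdc).
have XB := goods_X GB.
exists B; split=> //; first by split=> //; rewrite BC.
elim=> [|j IH] t e A A' jk BA BA'.
  rewrite (SatF_num K) // goods_satE; try by apply: CG; rewrite -BC.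
  apply: gclause_elem => //; first by rewrite BC.
  exact: goods_X.
rewrite (SatF_num K) // goods_satE; try by apply: CG; rewrite -BC.
apply: gclause_elem => //.
- by rewrite BC.
- exact: goods_X.
- by move=> m [<-]; exists j; split=> // *; apply: IH => //; apply: ltnW.
- by move=> m [<-]; exists j; split=> // *; apply: IH => //; apply: ltnW.
- move=> m u e' D [<-]; rewrite BC => CD [D' [GD' nD']].
  have [|D'' [CD'' nD'']] := hull_spec_TV (m := num j) (u := u) (e := e')
    goods_X HC CD.
    by exists D'; rewrite goods_sat_lt_num.
  by exists D''; split=> //; rewrite -(goods_sat_lt_num _ _ _ _ jk).
Qed.

Lemma tsat_refl B p v A A' : goods B -> (exists x, B x) ->
  (forall t e A A', fam B A -> fam B A' ->
    (SatF B (num (tdep p)) t e A A' <-> goods_sat (tdep p) t e A A')) ->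
  fam B A -> fam B A' -> (tsat (fam B) v A A' p <-> tsat goods v A A' p).
Proof.
move=> GB B0 HB BA BA'; have XB := goods_X GB.
have [e R] := Rep_ex Zf K (tkey p) v.
rewrite -(SatF_link K XB (leqnn _) (leqnn _) R) // HB //.
apply: (tsat_link K goods_X _ (leqnn _) (leqnn _) R).
- by move=> *; apply: goods_satE.
- exact: good_fam BA.
- exact: good_fam BA'.
Qed.

(** Truth up to the depth of [p] reflects to a good [B] above [A], and classes definable over
    [fam B] are sections of [B]. *)
Lemma goods_tm_closed : tm_closed goods.
Proof.
move=> p v A GA; have [B [GB bl HB]] := reflection (tdep p) GA.
exists B; split=> //; have [B0 BA] := bl.
have [m Hm] := good_tdef K p v GB BA B0; exists m => x; rewrite Hm.
by apply: tsat_refl => // *; apply: HB.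
Qed.

Lemma KM_sections_goods : KM E (sections goods).
Proof. exact: KM_sections init_goods goods_tm_closed. Qed.

End Uncoded.

Lemma KM_sections_ex : exists F, init F /\ KM E (sections F).
Proof.
case: (pselect (exists Z, X Z /\ fam Z = goods)) => [[Z [XZ ZG]]|unc].
  have [C [GC C0 KC]] := KM_sections_coded XZ ZG.
  by exists (fam C); split=> //; apply: init_fam.
by exists goods; split; [apply: init_goods|apply: KM_sections_goods].
Qed.

End Core.

(** * Goodness passes from a smaller realization to a larger one *)

Section Absolute.
Variables (M : Type) (E : M -> M -> Prop) (Zf : ZF E) (X Y : set (set M)).
Hypotheses (KX : KM E X) (KY : KM E Y) (YX : Y `<=` X).
Notation pr := (pr Zf).
Notation fam := (fam Zf).
Notation sec0 := (sec0 Zf).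

Lemma gclause_abs (I : Type) (J : I -> Prop) F s t e A B : F `<=` Y ->
  (gclause Zf Y J F s t e A B <-> gclause Zf X J F s t e A B).
Proof.
move=> FY; rewrite /gclause.
have -> // : (exists u, t = pr (num Zf 5) u /\
     forall m, J m -> forall B, Y B -> F B -> s m u e B A) <->
  (exists u, t = pr (num Zf 5) u /\
     forall m, J m -> forall B, X B -> F B -> s m u e B A).
split=> -[u [-> H]]; exists u; split=> // m Jm C HC FC; apply: H => //.
  exact: FY.
exact: YX.
Qed.

(** A truth class for [Z] in [Y] is still one in [X], because [fam Z] lies within [Y]; truth classes
    are unique. *)
Lemma SatF_abs Z n t e A B : Y Z -> fam Z A -> fam Z B ->
  (SatF Zf Y Z n t e A B <-> SatF Zf X Z n t e A B).
Proof.
move=> YZ ZA ZB; have [S [YS HS]] := sat_ex Zf KY YZ.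
rewrite (SatF_sigS KY n t e YZ YS HS) // (SatF_sigS KX n t e (YX YZ) (YX YS))
  //.
move=> n' t' e' k1 k2; rewrite HS; apply: gclause_abs => C.
exact: (fam_X KY YZ).
Qed.

Lemma Code_abs C : Y C -> Code Zf Y C C -> Code Zf X C C.
Proof.
move=> YC [HC [HC1 HC2]].
have FC z : fam C (sec0 C z) by exists z.
have CY : fam C `<=` Y by move=> B; apply: fam_X.
have pE d B z : fam C B -> (witness Zf (SatF Zf Y C) d B (sec0 C z) <->
    witness Zf (SatF Zf X C) d B (sec0 C z)).
  by move=> CB; split; apply: witness_ext => n u e; rewrite SatF_abs.
split; last split=> //.
  move=> x; case: (HC x) => [[d [z [xE [CB [pB HB]]]]]|[nx ->]].
    left; exists d, z; split=> //; split=> //; split; first exact/pE.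
    by move=> B' _ CB' /(pE _ _ _ CB'); apply: HB => //; apply: CY.
  right; split=> // -[d [z [xE [B' [_ [CB' pB']]]]]]; apply: nx.
  by exists d, z; split=> //; exists B'; split; [apply: CY|split=> //;
    apply/pE].
move=> n u e z y; rewrite HC1.
by split=> -[e' [? ?]]; exists e'; split=> //; apply/SatF_abs.
Qed.

(** Apart from truth, treated by [SatF_abs], only well-foundedness has a class quantifier not
    bounded by a family; it is settled by [wf_for_absolute]. *)
Lemma goods_abs : goods Zf Y `<=` goods Zf X.
Proof.
move=> C [YC gC]; split; first exact: YX.
case: gC => [->|[C0 [g1 [g2 [g3 [g4 g5]]]]]]; first by left.
have XC := YX YC.
have CY : fam C `<=` Y by move=> B; apply: fam_X.
right; split=> //; split.
  move=> A _ B _ CA bl; apply: (g1 A) => //; first exact: CY.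
  by apply: (fam_X (Zf := Zf) KY) (proj2 bl); apply: CY.
split; first by move=> A _ B _ CA CB; apply: g2 => //; apply: CY.
split; first by apply: (wf_for_absolute Zf KX KY) g3; pd.
split; first exact: Code_abs.
move=> A _ CA; have YA := CY A CA.
case: (g5 A YA CA) => [|[cA tA]]; [by left|right; split; first exact: Code_abs].
move=> B _ D _ AB bl; have YB : Y B by apply: fam_X AB.
by apply: (tA B) => //; apply: (fam_X (Zf := Zf) KY) (proj2 bl).
Qed.

End Absolute.

(** * A minimal realization from a beta-realization *)

Section Beta.
Variables (M : Type) (E : M -> M -> Prop) (Zf : ZF E) (X : set (set M)).
Hypothesis K : KM E X.
Notation pr := (pr Zf).
Notation sec0 := (sec0 Zf).
Notation fam := (fam Zf).
Notation below := (below Zf).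
Notation goods := (goods Zf X).

Notation sections := (sections Zf).
Notation init := (init Zf X).

Section Minimal.
Hypothesis beta : forall R, X R -> class_relation E R ->
  wf_for X (rel_of E R) -> wf_for setT (rel_of E R).

(** [Q] need not be definable: the order of the names in [B] is a relation of [X], so it is truly
    well founded by [beta]. *)
Lemma goods_true_least (Q : set (set M)) : Q `<=` goods -> Q !=set0 ->
  exists B, Q B /\ forall B', Q B' -> ~ below B' B.
Proof.
move=> QG [B QB]; have [XB gB] := QG B QB.
case: gB => [B0|[B0 [g1 [_ [g3 _]]]]].
  by exists B; split=> // B' _; rewrite B0; apply: below0.
pose R := [set p | exists n m, p = pr n m /\ below (sec0 B n) (sec0 B m)].
have XR : X R by apply: (class_comprehension K); pd.
have RE n m : rel_of E R n m <-> below (sec0 B n) (sec0 B m).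
  rewrite (rel_ofE Zf); split; last by exists n, m.
  by move=> [n' [m' [/pr_inj[-> ->]]]].
have Rrel : class_relation E R.
  by move=> p [n [m [-> _]]]; exists n, m; apply/(opair_pr Zf).
have wfR : wf_for X (rel_of E R).
  move=> A XA A0; have [x [Ax Hx]] := g3 A XA A0.
  by exists x; split=> // y Ay /RE; apply: Hx.
case: (pselect (exists n, Q (sec0 B n))) => Q0; last first.
  exists B; split=> // B' QB' [_ [n nE]]; apply: Q0; exists n; by rewrite -nE.
have [n [Qn Hn]] := beta XR Rrel wfR (A := [set n | Q (sec0 B n)]) I Q0.
exists (sec0 B n); split=> // B' QB' bl.
have [m mE] : fam B B'.
  apply: (g1 (sec0 B n)) => //; [exact: sec_X|exact: (proj1 (QG B' QB'))|].
  by exists n.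
by apply: (Hn m); [rewrite /= -mE|apply/RE; rewrite -mE].
Qed.

Lemma beta_minimal : exists N, minimal_KM_realization E N.
Proof.
(* [F] is the shortest initial segment whose sections form a realization: the family of the least
   suitable good class if there is one, otherwise all of [goods]. *)
have [F [iF KF Fmin]] : exists F, [/\ init F, KM E (sections F) &
    forall A, F A -> (exists x, A x) -> ~ KM E (sections (fam A))].
  pose Q A := [/\ goods A, exists x, A x & KM E (sections (fam A))].
  case: (pselect (exists A, Q A)) => [Q0|nQ].
    have [||A [[GA A0 KA] HA]] := @goods_true_least Q.
    - by move=> A [].
    - exact: Q0.
    exists (fam A); split=> //; first exact: init_fam.
    move=> B AB B0 KB; apply: (HA B) => //; split=> //; exact: good_fam AB.
  exists goods; split; first exact: init_goods.
    apply: KM_sections_goods => // -[Z [XZ ZG]].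
    by have [C [GC C0 KC]] := KM_sections_coded K XZ ZG; apply: nQ; exists C.
  by move=> A GA A0 KA; apply: nQ; exists A.
have [FG F0 Fdc] := iF.
exists (sections F); split=> // Y KY [YF]; apply.
have YX : Y `<=` X by move=> A /YF; apply: sections_sub.
(* [Y] yields a realization from its own good classes. These are good in [X] too, so [F'] can be
   compared with [F]. *)
have [F' [iF' KF']] := KM_sections_ex Zf KY.
have [F'G F'0 F'dc] := iF'.
have F'GX : F' `<=` goods by move=> A /F'G; apply: goods_abs.
suff FF' : F `<=` F'.
  by move=> D [A [x [FA ->]]]; apply: (sections_sub KY iF'); exists A, x;
    split=> //; apply: FF'.
apply: contrapT => nFF'.
(* The least class of [F] outside [F'] would have [F'] as its family, against the choice of [F]. *)
have [||A [[FA nF'A] HA]] := @goods_true_least [set A | F A /\ ~ F' A].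
- by move=> A [/FG].
- apply: contrapT => H; apply: nFF' => A FA; apply: contrapT => nA.
  by apply: H; exists A.
have A0 : exists x, A x by apply: contrapT => /nex_set0 A0; apply: nF'A;
  rewrite A0.
apply: (Fmin A) => //; suff -> : fam A = F' by [].
apply/seteqP; split=> J.
  move=> AJ; apply: contrapT => nJ; apply: (HA J) => //; split=> //.
  exact: (Fdc A).
move=> F'J; case: (good_compare K (F'GX J F'J) (FG A FA)) => [[]//|[JA|AJ]].
  by rewrite JA in F'J.
by case: nF'A; apply: F'dc AJ.
Qed.

End Minimal.

End Beta.

(** * From a minimal realization to true well-foundedness: elementary chains and the game *)

Section Chains.
Variables (M : Type) (E : M -> M -> Prop) (Zf : ZF E) (X : set (set M)).
Hypothesis K : KM E X.
Notation definable := (definable E X).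
Notation definable_term := (definable_term E X).
Notation definable_class := (definable_class E X).
Notation pr := (pr Zf).
Notation num := (num Zf).
Notation sec := (sec Zf).
Notation sing := (sing Zf).
Notation sec0 := (sec0 Zf).
Notation fam := (fam Zf).
Notation below := (below Zf).
Notation SatF := (SatF Zf X).
Notation goods := (goods Zf X).

Notation tsat := (tsat Zf).
Notation sections := (sections Zf).
Notation init := (init Zf X).
Notation goods_sat := (goods_sat Zf X).

(** Diagonalization over the pairs [pr a x], with [a] naming a class of [fam C] and [x] one of its
    sections. *)
Lemma diagonal C : X C -> exists D, X D /\ ~ sections (fam C) D.
Proof.
move=> XC; pose D := [set p | exists a x, p = pr a x /\ ~ sec (sec0 C a) x p].
exists D; split; first by apply: (class_comprehension K); pd.
move=> [A [x [[a ->] DE]]].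
have : ~ D (pr a x).
  move=> Dp; have := Dp; rewrite {1}DE => Cp.
  by case: Dp => a' [x' [/pr_inj[<- <-]]].
by move=> nD; apply: (nD); exists a, x; split=> //; rewrite -DE.
Qed.

Definition elem (n : M) (A B : set M) :=
  forall t e A1, X A1 -> forall A2, X A2 -> fam A A1 -> fam A A2 ->
  (SatF A n t e A1 A2 <-> SatF B n t e A1 A2).

Lemma fam_mono A B : goods B -> below A B -> fam A `<=` fam B.
Proof.
move=> GB bl C [k ->]; have [B0 _] := bl.
case: (pselect (exists x, A x)) => [A0|/nex_set0 ->];
  last exact: (good_fam0 GB B0).
have [//] : below (sec0 A k) B.
by apply: (good_trans K GB bl); split=> //; exists k.
Qed.

Lemma elem_sing n A B : goods A -> goods B -> below A B -> elem (sing n) A B ->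
  elem n A B.
Proof.
move=> GA GB bl H t e A1 X1 A2 X2 F1 F2; have sub := fam_mono GB bl.
have := H (pr (num 3) (pr t t)) e A1 X1 A2 X2 F1 F2.
rewrite !SatF_sing //; try exact: sub; try by case: GA; try by case: GB.
by move=> H'; split=> Hs; apply: contrapT => /H'.
Qed.

Section ElementaryChain.
Variable A : nat -> set M.
Hypothesis GA : forall j, goods (A j).
Hypothesis A0 : forall j, exists x, A j x.
Hypothesis Abelow : forall j, below (A j) (A j.+1).
Hypothesis Aelem : forall j, elem (num j) (A j) (A j.+1).

Definition limit_fam : set (set M) := fun B => exists j, fam (A j) B.

Let XA j : X (A j). Proof. by case: (GA j). Qed.

Lemma fam_le j l : j <= l -> fam (A j) `<=` fam (A l).
Proof.
move=> /subnK <-; elim: (l - j) => [//|d IH] B /IH; rewrite addSn.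
exact: fam_mono.
Qed.

(** As [num j.+1] is [sing (num j)], [elem_sing] lowers the index one step at a time. *)
Lemma elem_le_succ k j : k <= j -> elem (num k) (A j) (A j.+1).
Proof.
move=> /subnK <-; move: (j - k) => d.
suff H : forall i, i <= d -> elem (num (d - i + k)) (A (d + k)) (A (d + k).+1).
  by have := H d (leqnn d); rewrite subnn.
elim=> [|i IH] id; first by rewrite subn0; apply: Aelem.
apply: elem_sing => //.
have := IH (ltnW id); rewrite -(subnSK id) addSn //.
Qed.

Lemma elem_le k j l : k <= j -> j <= l -> elem (num k) (A j) (A l).
Proof.
move=> kj /subnK <-; elim: (l - j) => [|d IH] //; rewrite addSn.
move=> t e A1 X1 A2 X2 F1 F2; rewrite (IH t e A1 X1 A2 X2 F1 F2).
have sub := @fam_le j (d + j) (leq_addl _ _).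
apply: elem_le_succ => //; try exact: sub.
by rewrite (leq_trans kj) // leq_addl.
Qed.

Lemma init_limit : init limit_fam.
Proof.
split.
- by move=> B [j]; apply: good_fam.
- by exists 0; apply: (good_fam0 (GA 0)).
- move=> B C [j AB] bl; exists j.
  by have [] := good_trans K (GA j) (conj (A0 j) AB) bl.
Qed.

Lemma tsat_limit p : forall j v B C, tdep p <= j -> fam (A j) B ->
  fam (A j) C ->
  (tsat (fam (A j)) v B C p <-> tsat limit_fam v B C p).
Proof.
elim: p => [i k|i k|i k|p IHp q IHq|i p IHp|p IHp] j v B C // pj AB AC.
- move: pj; rewrite /= => pj.
  have [pj' qj'] : tdep p <= j /\ tdep q <= j.
    by split; apply: leq_trans (ltnW pj); rewrite leq_max leqnn // orbT.
  by rewrite IHp // IHq.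
- by split=> H x; apply/(IHp j (updv v i x)) => //; apply: ltnW.
- split=> [H D [l AD]|H D AD]; last first.
    by apply/(IHp j) => //; [apply: ltnW|apply: H; exists j].
  (* The instance [D] may appear only at stage [l]. Elementarity at the depth of the quantified term
     carries that term from stage [j] to a stage that contains [D]. *)
  pose m := maxn j l.
  have [jm lm] : j <= m /\ l <= m by rewrite leq_maxl leq_maxr.
  have [e R] := Rep_ex Zf K (tkey (TCAll p)) v.
  have XB := fam_X K (XA j) AB; have XC := fam_X K (XA j) AC.
  have : tsat (fam (A m)) v B C (TCAll p).
    apply/(SatF_link K (XA m) (leqnn _) (leqnn _) R); try exact: (fam_le jm).
    apply/(elem_le pj jm) => //.
    exact/(SatF_link K (XA j) (leqnn _) (leqnn _) R).
  move=> /(_ D (fam_le lm AD)) HD; apply/(IHp m) => //.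
  - by rewrite (leq_trans (ltnW pj)).
  - exact: (fam_le lm).
  - exact: (fam_le jm).
Qed.

Lemma limit_KM : KM E (sections limit_fam).
Proof.
apply: (KM_sections K init_limit) => p v B [j AB].
pose m := maxn j (tdep p).
have [jm pm] : j <= m /\ tdep p <= m by rewrite leq_maxl leq_maxr.
have AmB := fam_le jm AB.
exists (A m); split; first by exists m.+1; case: (Abelow m).
have [n Hn] := good_tdef K p v (GA m) AmB (A0 m); exists n => x.
by rewrite Hn; apply: tsat_limit.
Qed.

End ElementaryChain.

Section Game.
Hypothesis unc : ~ exists Z, X Z /\ fam Z = goods.
Variable lt : M -> M -> Prop.
Hypothesis Hlt : definable (fun v V => lt (v 0) (v 1)).
Hypothesis lt_wf : wf_for X lt.

(* [S (w, (n, a))] allows to continue from the code named [a] in [Gam] with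
   [w]-many steps, each of them elementary for one more quantifier. *)
Definition game (Gam S : set M) := forall w n a, S (pr w (pr n a)) ->
  forall w', lt w' w -> exists b, S (pr w' (pr (sing n) b)) /\
    (below (sec0 Gam a) (sec0 Gam b) /\ elem n (sec0 Gam a) (sec0 Gam b)).

Lemma definable_game F H : definable_class F -> definable_class H ->
  definable (fun v V => game (F v V) (H v V)).
Proof. by move=> HF HH; rewrite /game /elem /sing; pd. Qed.

Definition wins (Gam : set M) (w n : M) (A : set M) :=
  exists S, X S /\ (game Gam S /\
    exists a, A = sec0 Gam a /\ S (pr w (pr n a))).

Lemma definable_wins F w n H : definable_class F -> definable_term w ->
  definable_term n -> definable_class H ->
  definable (fun v V => wins (F v V) (w v V) (n v V) (H v V)).
Proof.
move=> HF Hw Hn HH; rewrite /wins; apply: definable_cex; apply: definable_and;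
  last by pd.
by apply: definable_game; pd.
Qed.

Lemma above2 A B : goods A -> goods B ->
  exists C, [/\ goods C, below A C & below B C].
Proof.
move=> GA GB; case: (good_compare K GA GB) => [AB|[<-|BA]].
- have [C [GC BC _]] := reflection K unc 0 GB; exists C; split=> //.
  exact: (good_trans K GC BC).
- by have [C [GC AC _]] := reflection K unc 0 GA; exists C.
- have [C [GC AC _]] := reflection K unc 0 GA; exists C; split=> //.
  exact: (good_trans K GC AC).
Qed.

(** By induction on true accessibility. One answer serves every [w']: a good [B] above [A] that
    reflects the next level. Each [w'] is won from [B] inside some code, and [collect] puts these
    codes below a single one. *)
Lemma acc_wins w : Acc lt w -> forall k A, goods A ->
  (forall t e A1 A2, fam A A1 -> fam A A2 ->
     (SatF A (num k) t e A1 A2 <-> goods_sat k t e A1 A2)) ->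
  exists Gam, goods Gam /\ wins Gam w (num k) A.
Proof.
elim=> {}w _ IH k A GA Ak.
have [B [GB AB Bk]] := reflection K unc k.+1 GA.
have XA : X A by case: GA.
have XB : X B by case: GB.
have ABe : elem (num k) A B.
  move=> t e A1 _ A2 _ F1 F2; rewrite Ak // Bk //; exact: (fam_mono GB AB).
have [||Gam0 [GGam0 HGam0]] :=
    collect K unc (P := fun w' Gam => lt w' w -> wins Gam w' (num k.+1) B).
- by apply: definable_imp; [pd|apply: definable_wins; pd].
- move=> w'; case: (pselect (lt w' w)) => [lw|nlw]; last first.
    by exists set0; split=> //; apply: good_set0.
  have [|Gam [GGam HGam]] := IH w' lw k.+1 B GB; last by exists Gam.
  by move=> *; apply: Bk.
have [Gam1 [GGam1 bl01 blB1]] := above2 GGam0 GB.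
have XGam1 : X Gam1 by case: GGam1.
have sub1 Gam : below Gam Gam1 -> fam Gam `<=` fam Gam1 by apply: fam_mono.
(* The strategy has the starting position and every position won inside a code below [Gam1], renamed
   to names in [Gam1]. *)
pose S := [set p | exists w' n b, p = pr w' (pr n b) /\
  ((exists Gam, X Gam /\ (below Gam Gam1 /\ wins Gam w' n (sec0 Gam1 b))) \/
   (w' = w /\ n = num k /\ sec0 Gam1 b = A))].
have XS : X S.
  apply: (class_comprehension K); do 3!apply: definable_ex;
    apply: definable_and; first by pd.
  apply: definable_or; last by pd.
  by apply: definable_cex; apply: definable_and; [pd|apply: definable_wins; pd].
have [a aE] : fam Gam1 A by apply: (sub1 B) => //; case: AB.
have [b bE] : fam Gam1 B by case: blB1.
exists Gam1; split=> //; exists S; split=> //; split; last first.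
  exists a; split=> //; exists w, (num k), a; split=> //; by right.
move=> w1 n1 a1 [w2 [n2 [b2 [/pr_inj[-> /pr_inj[-> ->]] H]]]] {w1 n1 a1} w' lw.
case: H => [[Gam [XGam [bl [S' [XS' [gS' [c [cE Sc]]]]]]]]|[wE [nE bA]]].
  have [d [Sd [bld eld]]] := gS' _ _ _ Sc _ lw.
  have [d' dE] : fam Gam1 (sec0 Gam d) by apply: (sub1 Gam) => //; exists d.
  exists d'; rewrite cE -dE; split=> //.
  exists w', (sing n2), d'; split=> //; left; exists Gam; do 2!split=> //.
  by rewrite -dE; exists S'; do 2!split=> //; exists d.
subst w2 n2; exists b; rewrite bA -bE; split=> //.
exists w', (num k.+1), b; split=> //; left.
have [Gam [bl wG]] := HGam0 w'.
have XGam : X Gam by apply: (fam_X K (proj1 GGam0)) (proj2 bl).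
exists Gam; split=> //; split; first exact: (good_trans K GGam1 bl01).
by rewrite -bE; apply: wG.
Qed.

Lemma illfounded_chain w : ~ Acc lt w ->
  exists Gam A, [/\ goods Gam, (forall j, goods (A j) /\ exists x, A j x),
    (forall j, below (A j) (A j.+1)), (forall j, elem (num j) (A j) (A j.+1)) &
    forall j, fam Gam (A j)].
Proof.
move=> nw.
have [A0 [GA0 bl0 refl0]] := reflection K unc 0 (good_set0 Zf K).
have XA0 : X A0 by case: GA0.
have HG : definable (fun v V => goods (V 0)) by apply: (definable_goods Zf K);
  pd.
pose U := [set w | ~ exists Gam, X Gam /\ (goods Gam /\ wins Gam w (num 0) A0)].
have XU : X U.
  apply: (class_comprehension K); apply: definable_not; apply: definable_cex;
    apply: definable_and; first by pd.
  by apply: definable_wins; pd.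
(* Overspill: accessible points win by [acc_wins]. If no others did, [U] would be the inaccessible
   part, which has no least element although it belongs to [X]. *)
have [w0 [nw0 [Gam [GGam [S [XS [gS [a0 [aE S0]]]]]]]]] :
    exists w0, ~ Acc lt w0 /\ exists Gam, goods Gam /\ wins Gam w0 (num 0) A0.
  apply: contrapT => H.
  have [|u [Uu Hu]] := lt_wf XU.
    exists w => -[Gam [_ [GGam wG]]]; apply: H; exists w; split=> //.
    by exists Gam.
  have [||Gam [GGam wG]] := @acc_wins u _ 0 A0 GA0.
  - constructor=> y ly; apply: contrapT => ny; apply: (Hu y) => //.
    move=> [Gam [_ [GGam wG]]]; apply: H; exists y; split=> //; by exists Gam.
  - by move=> *; apply: refl0.
  apply: Uu; exists Gam; split=> //; by case: GGam.
(* An inaccessible point has an inaccessible predecessor, so play from such a position never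
   stops. *)
pose st j := {p : M * M | ~ Acc lt p.1 /\ S (pr p.1 (pr (num j) p.2))}.
pose ok j (p : st j) (q : st j.+1) :=
  below (sec0 Gam (sval p).2) (sec0 Gam (sval q).2) /\
  elem (num j) (sec0 Gam (sval p).2) (sec0 Gam (sval q).2).
have step j (p : st j) : exists q : st j.+1, ok j p q.
  case: p => -[w1 a1] /= [nw1 S1].
  have [w2 [lw nw2]] : exists w2, lt w2 w1 /\ ~ Acc lt w2.
    apply: contrapT => H; apply: nw1; constructor=> y ly; apply: contrapT => ny.
    by apply: H; exists y.
  have [b [Sb [blb elb]]] := gS _ _ _ S1 _ lw.
  by exists (exist _ (w2, b) (conj nw2 Sb)).
pose seqs := fix seqs j : st j := match j with
  | 0 => exist _ (w0, a0) (conj nw0 S0)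
  | i.+1 => sval (cid (step i (seqs i))) end.
have seqsP j : ok j (seqs j) (seqs j.+1) by rewrite /=; case: cid.
pose A j := sec0 Gam (sval (seqs j)).2.
have A00 : A 0 = A0 by rewrite aE.
have Gam0 : exists x, Gam x.
  have [[x Ax] _] := (seqsP 0).1.
  by exists (pr (pr (num 0) (sval (seqs 1)).2) x).
exists Gam, A; split=> //.
- move=> j; split.
    by apply: (good_fam K GGam Gam0); exists (sval (seqs j)).2.
  case: j => [|j]; first by rewrite A00; case: bl0.
  by case: (seqsP j) => -[].
- by move=> j; case: (seqsP j).
- by move=> j; case: (seqsP j).
- by move=> j; exists (sval (seqs j)).2.
Qed.

End Game.

Hypothesis Xmin : forall Y, KM E Y -> ~ Y `<` X.

Lemma minimal_uncoded : ~ exists Z, X Z /\ fam Z = goods.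
Proof.
move=> [Z [XZ ZG]]; have [C [GC C0 KC]] := KM_sections_coded K XZ ZG.
have XC : X C by case: GC.
apply: (Xmin KC); split; first by apply: (sections_sub K); apply: init_fam.
by move=> H; have [D [/H]] := diagonal XC.
Qed.

(** An inaccessible point gives an infinite elementary chain inside one code [Gam]. The limit
    realization is then contained in [X], yet misses the diagonal class of [Gam], against
    minimality. *)
Lemma minimal_acc lt : definable (fun v V => lt (v 0) (v 1)) -> wf_for X lt ->
  forall w, Acc lt w.
Proof.
move=> Hlt wf w; apply: contrapT => nw.
have [Gam [A [GGam GA0 Abl Ael GamA]]] := illfounded_chain minimal_uncoded Hlt
  wf nw.
have GA j := proj1 (GA0 j); have A0 j := proj2 (GA0 j).
have XGam : X Gam by case: GGam.
have iF := init_limit GA A0.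
apply: (Xmin (limit_KM GA A0 Abl Ael)); split; first exact: (sections_sub K).
move=> H; have [D [/H [B [x [[j AB] ->]]]]] := diagonal XGam; apply.
exists B, x; split=> //; apply: (fam_mono (A := A j) GGam) => //.
split=> //; have [y Ay] := A0 j; have [k kE] := GamA j.
by move: Ay; rewrite kE; exists (pr (pr (num 0) k) y).
Qed.

End Chains.

(** * Accessibility, the transitive collapse and the equivalence *)

Lemma Acc_wf_for (M : Type) (lt : M -> M -> Prop) :
  (forall x, Acc lt x) -> wf_for setT lt.
Proof.
move=> acc A _ [x Ax]; apply: contrapT => H.
elim: (acc x) Ax => {}x _ IH Ax; apply: H; exists x; split=> // y Ay lyx.
exact: IH lyx Ay.
Qed.

Lemma veq_refl a : veq a a.
Proof. by elim: a => A f IH /=; split=> x; exists x. Qed.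

Lemma mostowski (M : Type) (E : M -> M -> Prop) : ZF E ->
  (forall x, Acc E x) -> transitive_model E.
Proof.
move=> Zf wf.
pose c := Fix wf (fun=> vset) (fun x f =>
  VSup (fun y : {y | E y x} => f (sval y) (svalP y))).
have cE x : c x = VSup (fun y : {y | E y x} => c (sval y)).
  rewrite /c Fix_eq // => y f g fg; congr VSup; apply: funext => z; exact: fg.
have cinj x : forall y, veq (c x) (c y) -> x = y.
  elim: (wf x) => {}x _ IH y; rewrite !cE => -[H1 H2].
  apply: (ZF_extensionality Zf) => z; split=> Ez.
    have [[u Eu] /= H] := H1 (exist _ z Ez).
    by rewrite (IH z Ez u H).
  have [[u Eu] /= H] := H2 (exist _ z Ez).
  by rewrite -(IH u Eu z H).
exists c; split=> //; split=> x y; rewrite (cE y) /=.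
  split=> [Exy|[[u Eu] /= H]]; last by rewrite (cinj _ _ H).
  by exists (exist _ x Exy); apply: veq_refl.
by move=> [[u Eu] /= H]; exists u.
Qed.

Theorem theorem6p9 (M : Type) (E : M -> M -> Prop)
    (M_countable : countable [set: M]) (M_ZF : ZF E) :
  (exists X : set (set M), minimal_KM_realization E X) <->
  (exists X : set (set M), beta_KM_realization E X).
Proof.
split=> [[X [K Xmin]]|[X [K _ beta]]]; last exact: (beta_minimal M_ZF K beta).
(* Applied to [E] this gives the transitive collapse, applied to a relation of [X] the beta
   property. *)
have acc := minimal_acc M_ZF K Xmin.
have HE : definable E X (fun v V => E (v 0) (v 1)) by pd.
exists X; split; first exact: K.
  exact: (mostowski M_ZF (acc E HE (E_wf M_ZF K))).
move=> R XR _ wf; apply: Acc_wf_for.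
have HR : definable E X (fun v V => rel_of E R (v 0) (v 1)).
  apply: (definable_ext (Q := fun v V => R (pr M_ZF (v 0) (v 1)))).
    by move=> v V _; rewrite (rel_ofE M_ZF).
  by pd.
exact: (acc (rel_of E R) HR wf).
Qed.
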